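(* There exist absolute constants $k_0$, $C>0$ and $\delta>0$ such that for all $k\ge k_0$ and all $\mathsf p$ with $Ck/2^k\le\mathsf p^2\le1$ (corresponding to $1\le\mathbf c(\mathsf p)\le2^k/k$), $$\alpha_{\max}(\mathsf p)\le\{1-\delta\,x(\mathsf p)\}\,\alpha_{\mathrm{ubd}}(\mathsf p).$$
   Context: **Model.** For positive integers $d,k$, $\alpha=d/k$, and $N$ with $M=Nd/k$ an integer, a random $d$-regular $k$-NAE-SAT instance $\mathcal G_N$ is a random bipartite multigraph with $N$ variables and $M$ clauses: each variable gets $d$ half-edges, each clause gets $k$ half-edges, joined by a uniformly random matching; each edge $e$ carries an independent uniform label $L_e\in\{0,1\}$. For $\underline x\in\{0,1\}^N$ a clause is violated iff the $k$ values $L_e\oplus x_{v(e)}$ over its edges $e$ are all equal. $\mathsf e_{\min}(\mathcal G_N)=\frac1N\min_{\underline x}\#\{\text{clauses violated by }\underline x\}$. **Energy parametrization.** Energies are parametrized as $\mathsf e=\alpha(1-\mathsf p)/2^{k-1}$. Define $\mathsf p^\bullet(\alpha)$ by $\liminf_{N\to\infty}\mathbb E[\mathsf e_{\min}(\mathcal G_N)]=\alpha(1-\mathsf p^\bullet(\alpha))/2^{k-1}$. The inequality ''$\alpha_{\max}(\mathsf p)\le\alpha$'' means by definition that $\mathsf p^\bullet(\alpha')<\mathsf p$ for all $\alpha'>\alpha$ (with $\alpha'$ of the form $d/k$). **Functions of $\mathsf p$.** (Convention $0\ln0=0$.) Let $$\mathbf c(\mathsf p)=\frac1{(2^{k-1}-(1-\mathsf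 p))\ln\frac{2^{k-1}-(1-\mathsf p)}{2^{k-1}-1}+(1-\mathsf p)\ln(1-\mathsf p)},\qquad\alpha_{\mathrm{ubd}}(\mathsf p)=\mathbf c(\mathsf p)\,2^{k-1}\ln2,$$ $$\eta(\mathsf p)=\frac{(1-\mathsf p)(2^{k-1}-1)}{2^{k-1}-(1-\mathsf p)},\qquad x(\mathsf p)=\left(\frac{\exp\{-(k\ln2)\cdot2\mathbf c(\mathsf p)(1-\eta(\mathsf p)^{1/2})^2\}}{\max\{\mathbf c(\mathsf p)\,k\,\eta(\mathsf p)^{1/2},1\}}\right)^{1/2}.$$
   Formalization: The formal statement adds p ≥ 0: the condition Ck/2^k ≤ p² ≤ 1 alone also admits negative p, for which the inequality always fails because p•(α) ≥ 0 (a random assignment violates a fraction 2^{-(k-1)} of the clauses on average). *)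

(* Defs.v *)
From HB Require Import structures.
From mathcomp Require Import all_boot all_order all_algebra.
From mathcomp Require Import all_classical all_reals all_analysis.

Set Implicit Arguments.
Unset Strict Implicit.
Unset Printing Implicit Defensive.

Import Order.TTheory GRing.Theory Num.Theory.

Local Open Scope ring_scope.

(* Half-edge (v, i) is the i-th half-edge of variable v, and (a, j) the j-th
   half-edge of clause a.  Edges are indexed by their clause half-edge: G.1
   maps it to the matched variable half-edge and G.2 is the edge label.
   Parallel edges are allowed. *)
Definition configuration (N M d k : nat) : finType :=
  ({ffun 'I_M * 'I_k -> 'I_N * 'I_d} * {ffun 'I_M * 'I_k -> bool})%type.

Definition instances (N M d k : nat) : {set configuration N M d k} :=
  [set G : configuration N M d k |
    injectiveb G.1 && [forall h, exists e, G.1 e == h]].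

Definition literal (N M d k : nat) (G : configuration N M d k)
    (x : {ffun 'I_N -> bool}) (a : 'I_M) (j : 'I_k) : bool :=
  G.2 (a, j) (+) x (G.1 (a, j)).1.

Definition violated (N M d k : nat) (G : configuration N M d k)
    (x : {ffun 'I_N -> bool}) (a : 'I_M) : bool :=
  [forall i : 'I_k, forall j : 'I_k, literal G x a i == literal G x a j].

Definition num_violated (N M d k : nat) (G : configuration N M d k)
    (x : {ffun 'I_N -> bool}) : nat :=
  #|[set a : 'I_M | violated G x a]|.

Definition min_violated (N M d k : nat) (G : configuration N M d k) : nat :=
  num_violated G [arg min_(x < [ffun=> false]) num_violated G x].

Definition e_min (R : realType) (N M d k : nat) (G : configuration N M d k) : R :=
  (min_violated G)%:R / N%:R.

(* Meaningful when k divides N * d. *)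
Definition expected_e_min (R : realType) (d k N : nat) : R :=
  (\sum_(G in instances N (N * d %/ k) d k) e_min R G) /
    #|instances N (N * d %/ k) d k|%:R.

Definition liminf_e_min (R : realType) (d k : nat) : \bar R :=
  limf_einf (fun N => (expected_e_min R d k N)%:E)
    (within [set N | (k %| N * d)%N]%classic \oo%classic).

(* The solution p of liminf = alpha (1 - p) / 2^(k-1), where alpha = d / k;
   see [p_bulletE]. *)
Definition p_bullet (R : realType) (d k : nat) : R :=
  1 - fine (liminf_e_min R d k) * 2 ^+ k.-1 / (d%:R / k%:R).

(* The assertion alpha_max(p) <= alpha: strictly above alpha, among the
   admissible values d / k, one has p_bullet < p. *)
Definition alpha_max_le (R : realType) (k : nat) (p alpha : R) : Prop :=
  forall d : nat, (0 < d)%N -> alpha < d%:R / k%:R -> p_bullet R d k < p.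

(* At p = 1 the last term is 0 * ln 0 = 0, whatever the value of ln 0. *)
Definition c_p (R : realType) (k : nat) (p : R) : R :=
  ((2 ^+ k.-1 - (1 - p)) * ln ((2 ^+ k.-1 - (1 - p)) / (2 ^+ k.-1 - 1))
    + (1 - p) * ln (1 - p))^-1.

Definition alpha_ubd (R : realType) (k : nat) (p : R) : R :=
  c_p k p * 2 ^+ k.-1 * ln 2.

Definition eta_p (R : realType) (k : nat) (p : R) : R :=
  (1 - p) * (2 ^+ k.-1 - 1) / (2 ^+ k.-1 - (1 - p)).

Definition x_p (R : realType) (k : nat) (p : R) : R :=
  Num.sqrt
    (expR (- (k%:R * ln 2 * (2 * c_p k p * (1 - Num.sqrt (eta_p k p)) ^+ 2)))
      / Num.max (c_p k p * k%:R * Num.sqrt (eta_p k p)) 1).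

Lemma min_violatedP (N M d k : nat) (G : configuration N M d k) :
  (exists x, num_violated G x = min_violated G) /\
  (forall x, (min_violated G <= num_violated G x)%N).
Proof.
split; first by eexists.
by move=> x; rewrite /min_violated; case: arg_minnP => // y _; apply.
Qed.

Lemma instances_gt0 (N M d k : nat) : (M * k = N * d)%N ->
  (0 < #|instances N M d k|)%N.
Proof.
move=> MkNd.
have E : #|{: 'I_M * 'I_k}| = #|{: 'I_N * 'I_d}| by rewrite !card_prod !card_ord.
pose m : {ffun 'I_M * 'I_k -> 'I_N * 'I_d} :=
  [ffun e => enum_val (cast_ord E (enum_rank e))].
apply/card_gt0P; exists (m, [ffun=> false]); rewrite inE /=; apply/andP; split.
  apply/injectiveP => e f; rewrite !ffunE => /enum_val_inj /cast_ord_inj.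
  exact: enum_rank_inj.
apply/forallP => h; apply/existsP.
exists (enum_val (cast_ord (esym E) (enum_rank h))).
by rewrite ffunE enum_valK cast_ordKV enum_rankK.
Qed.

Lemma e_min_bounds (R : realType) (N M d k : nat) (G : configuration N M d k) :
  0 <= e_min R G <= M%:R / N%:R.
Proof.
rewrite /e_min divr_ge0//= ler_wpM2r ?invr_ge0// ler_nat.
by rewrite /min_violated /num_violated (leq_trans (max_card _))// card_ord.
Qed.

Lemma expected_e_min_bounds (R : realType) (d k N : nat) :
  0 <= expected_e_min R d k N <= (N * d %/ k)%N%:R / N%:R.
Proof.
rewrite /expected_e_min; set I := instances _ _ _ _.
apply/andP; split.
  by rewrite divr_ge0// sumr_ge0// => G _; case/andP: (e_min_bounds R G).
have [->|I0] := eqVneq #|I| 0%N; first by rewrite invr0 mulr0 divr_ge0.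
rewrite ler_pdivrMr ?ltr0n ?lt0n// mulr_natr -sumr_const.
by apply: ler_sum => G _; case/andP: (e_min_bounds R G).
Qed.

Lemma liminf_e_min_fin_num (R : realType) (d k : nat) : (0 < k)%N ->
  liminf_e_min R d k \is a fin_num.
Proof.
move=> k0; rewrite /liminf_e_min limf_einfE; set F := within _ _.
have lb : (0 <= ereal_sup [set ereal_inf
    ((fun N => (expected_e_min R d k N)%:E) @` V) | V in F])%E.
  apply: le_ereal_sup_tmp; exists (ereal_inf
    ((fun N => (expected_e_min R d k N)%:E) @` setT)).
    by exists setT => //; exact: (@filterT _ F).
  apply: le_ereal_inf_tmp => _ [N _ <-]; rewrite lee_fin.
  by case/andP: (expected_e_min_bounds R d k N).
have ub : (ereal_sup [set ereal_inf
    ((fun N => (expected_e_min R d k N)%:E) @` V) | V in F] <= (d%:R)%:E)%E.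
  apply: ge_ereal_sup => _ [V [n _ nV] <-].
  have VN : V (k * n.+1)%N.
    apply: nV => /=; first by rewrite (leq_trans (leqnSn n))// leq_pmull.
    by rewrite -mulnA dvdn_mulr.
  apply: ge_ereal_inf; exists (expected_e_min R d k (k * n.+1))%:E.
    by exists (k * n.+1)%N.
  rewrite lee_fin; case/andP: (expected_e_min_bounds R d k (k * n.+1)) => _.
  move=> /le_trans; apply.
  rewrite ler_pdivrMr ?ltr0n ?muln_gt0 ?k0// -natrM ler_nat.
  by rewrite -mulnA mulKn// [leqRHS]mulnC leq_mul2r leq_pmull ?orbT.
by rewrite fin_numElt (lt_le_trans _ lb)//= (le_lt_trans ub)// ltry.
Qed.

Lemma p_bulletE (R : realType) (d k : nat) : (0 < d)%N -> (0 < k)%N ->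
  liminf_e_min R d k =
    ((d%:R / k%:R) * (1 - p_bullet R d k) / 2 ^+ k.-1)%:E.
Proof.
move=> d0 k0; rewrite -[LHS]fineK ?liminf_e_min_fin_num//; congr (_%:E).
rewrite /p_bullet subKr [X in X / _]mulrC mulfVK ?mulfK ?expf_neq0 ?pnatr_eq0//.
by rewrite mulf_neq0 ?invr_eq0 ?pnatr_eq0 -?lt0n.
Qed.

(* Main.v *)
Require Import Defs.
From mathcomp Require Import all_boot all_order all_algebra.
From mathcomp Require Import all_classical all_reals all_analysis.
From mathcomp Require Import fingroup perm.
From mathcomp Require Import ring lra zify.
Import Order.TTheory GRing.Theory Num.Theory.
Local Open Scope ring_scope.
Set Implicit Arguments.
Unset Strict Implicit.
Unset Printing Implicit Defensive.

(** Why the theorem holds.  Put [q = 2 / 2 ^ k].  For a fixed assignment the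
    literals seen by the clauses are independent fair bits, so each clause is
    violated with probability [q], independently of the matching, and the first
    moment of the number of assignments with energy at most
    [alpha * q * (1 - p)] per variable is
    at most [exp (N * (ln 2 - alpha * q / c_p))], which decays when
    [alpha > alpha_ubd].  To gain the factor [1 - delta * x_p] it is enough to
    count only some of these assignments: the minimizers with the largest number
    of ones ([extremal_minimizer]).  For such an assignment, turning a zero into
    a one must create strictly more violated clauses than it repairs.

    Given that the energy is [alpha * q * (1 - p)], an edge lies in a violated
    clause with probability about [a], and is the only one that keeps its clause
    satisfied with probability about [b], where [a / b = eta_p].  Along the [d]
    edges at a variable the number of violated clauses that a flip creates, minus
    the number it repairs, is thus a lazy random walk with up-steps of
    probability [b] and down-steps of probability [a].  The walk ends at or below
    its start with probability of the order of
    [exp (- d * (sqrt b - sqrt a) ^ 2)] divided by the square root of the number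
    of nonzero steps ([return_ge]): an exponential tilt makes the walk symmetric,
    and a symmetric walk returns with probability of the order of the inverse of
    its standard deviation.  For [alpha] near [alpha_ubd] this quantity is [x_p]
    up to a constant.  Hence every zero of an extremal minimizer costs a factor
    [1 - g / 2] with [g] of the order of [x_p], and the sum over assignments
    drops from [2 ^ N] to [(2 - g / 2) ^ N].

    Three points make this rigorous.  A variable with two edges in one clause
    does not obey the description above, but there are [O(1)] such variables on
    average, so up to a probability [O(1 / N)] there are at most a small multiple
    of [N] of them ([doubled_rare]).  Given the literals, the types of the edges
    are spread over the variables by a uniformly random bijection; by
    exchangeability and Stirling's formula this is at most polynomially worse
    than independent sampling from the empirical distribution of the types
    ([matchings_vs_iid]).  Finally the empirical frequencies have to be close to
    [a] and [b].  Since [g] only decreases when violated edges become rarer or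
    critical edges more frequent ([iter_walk_mono]), only two one-sided
    deviations matter; the window [narrow_window] is so narrow that [g] changes
    by a bounded factor inside it, while leaving it costs at least of the order
    of [1 / k ^ 2] per variable in the exponent ([energy_fraction_window]).  As
    [x_p] is itself [O(1 / k ^ 2)], a small [delta] makes this cost larger than
    the loss of [delta * x_p] in the first moment.

    For [p] in the open unit interval these estimates give [p_bullet <= p] as
    soon as [alpha > (1 - delta * x_p) * alpha_ubd] ([p_bullet_le]).  The strict inequality, and the value [p = 1], follow by
    continuity of the bound in [p]: it can be applied at some smaller [p]. *)

(** * Lazy random walks on the integers *)

Section Walk.
Variable R : realType.
Implicit Types (a b p : R) (u v : int -> R) (s t : int) (n d : nat).

(** Transition operator: its [n]-th iterate sends [u] to the expectation of
    [u] after [n] steps, as a function of the starting point. *)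
Definition walk a b u s : R :=
  a * u (s - 1) + (1 - a - b) * u s + b * u (s + 1).

Definition delta_at s0 : int -> R := fun s => (s == s0)%:R.

Lemma iter_walk_le a b n u v : 0 <= a -> 0 <= b -> a + b <= 1 ->
  (forall s, u s <= v s) ->
  forall s, iter n (walk a b) u s <= iter n (walk a b) v s.
Proof.
move=> a0 b0 ab uv; elim: n => //= n IH s.
rewrite /walk !lerD ?ler_wpM2l ?IH//; lra.
Qed.

Lemma iter_walk_ge0 a b n u : 0 <= a -> 0 <= b -> a + b <= 1 ->
  (forall s, 0 <= u s) -> forall s, 0 <= iter n (walk a b) u s.
Proof.
move=> a0 b0 ab u0; elim: n => //= n IH s.
by rewrite /walk !addr_ge0 ?mulr_ge0 ?IH//; lra.
Qed.

Lemma iter_walk_const a b n (c : R) s : iter n (walk a b) (fun=> c) s = c.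
Proof. by elim: n s => //= n IH s; rewrite /walk !IH; ring. Qed.

Lemma eq_iter_walk a b n u v : u =1 v ->
  iter n (walk a b) u =1 iter n (walk a b) v.
Proof. by move=> uv; elim: n => //= n IH s; rewrite /walk !IH. Qed.

Lemma iter_walk_sum a b n m (c : 'I_m -> R) (f : 'I_m -> int -> R) s :
  iter n (walk a b) (fun s => \sum_(i < m) c i * f i s) s =
  \sum_(i < m) c i * iter n (walk a b) (f i) s.
Proof.
elim: n s => //= n IH s; rewrite /walk !IH !mulr_sumr -!big_split /=.
by apply: eq_bigr => i _; ring.
Qed.

Lemma iter_walk_affine a b n (c e : R) u s :
  iter n (walk a b) (fun s => c + e * u s) s = c + e * iter n (walk a b) u s.
Proof. by elim: n s => //= n IH s; rewrite /walk !IH; ring. Qed.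

(** Making up-steps rarer or down-steps likelier can only increase the
    chance of ending low. *)
Lemma iter_walk_mono a b a' b' n u :
  0 <= a' -> 0 <= b -> a' <= a -> b <= b' -> a + b <= 1 -> a' + b' <= 1 ->
  (forall s, u (s + 1) <= u s) ->
  forall s, iter n (walk a' b') u s <= iter n (walk a b) u s.
Proof.
move=> a'0 b0 a'a bb' ab a'b' uD.
have uD' m s : iter m (walk a b) u (s + 1) <= iter m (walk a b) u s.
  elim: m s => //= m IH s; rewrite /walk.
  have IHl : iter m (walk a b) u (s + 1 - 1) <= iter m (walk a b) u (s - 1).
    by have := IH (s - 1); rewrite subrK addrK.
  by apply: lerD; [apply: lerD|]; apply: ler_wpM2l; rewrite ?IHl ?IH//; lra.
elim: n => //= n IH s.
apply: (@le_trans _ _ (walk a' b' (iter n (walk a b) u) s)).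
  by rewrite /walk !lerD ?ler_wpM2l ?IH//; lra.
rewrite /walk -subr_ge0.
set x := iter n _ _ (s - 1); set y := iter n _ _ s; set z := iter n _ _ (s + 1).
have yz : 0 <= y - z by rewrite subr_ge0; exact: uD'.
have xy : 0 <= x - y by rewrite subr_ge0; have := uD' n (s - 1); rewrite subrK.
have -> : a * x + (1 - a - b) * y + b * z - (a' * x + (1 - a' - b') * y + b' * z)
   = (a - a') * (x - y) + (b' - b) * (y - z) by ring.
by rewrite addr_ge0// mulr_ge0// subr_ge0.
Qed.

Lemma iter_walk_sqr p n s :
  iter n (walk p p) (fun s => s%:~R ^+ 2) s = s%:~R ^+ 2 + 2 * p * n%:R.
Proof.
elim: n s => [|n IH] s /=; first by rewrite mulr0 addr0.
rewrite /walk !IH intrB intrD mulrS; ring.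
Qed.

Lemma iter_walk_refl p n s0 s :
  iter n (walk p p) (delta_at s0) s = iter n (walk p p) (delta_at 0) (s0 - s).
Proof.
elim: n s => [|n IH] s /=.
  by rewrite /delta_at subr_eq0 eq_sym.
rewrite /walk !IH.
have -> : s0 - (s - 1) = s0 - s + 1 by ring.
have -> : s0 - (s + 1) = s0 - s - 1 by ring.
ring.
Qed.

Lemma window_Chebyshev (w : nat) s :
  1 - s%:~R ^+ 2 / w.+1%:R ^+ 2 <=
  \sum_(i < w.*2.+1) 1 * delta_at (i%:Z - w%:Z) s.
Proof.
have [sw|sw] := leP `|s| w%:Z.
  have iw : (absz (s + w%:Z)%R < w.*2.+1)%N by lia.
  rewrite (bigD1 (Ordinal iw))//= /delta_at.
  have -> : (s == (absz (s + w%:Z)%R)%:Z - w%:Z) by lia.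
  rewrite mul1r; apply: lerD => //.
  apply: (@le_trans _ _ 0); first by rewrite oppr_le0 divr_ge0// sqr_ge0.
  by apply: sumr_ge0 => i _; rewrite mul1r.
apply: (@le_trans _ _ 0); last by apply: sumr_ge0 => i _; rewrite mul1r.
rewrite subr_le0 ler_pdivlMr ?exprn_gt0// mul1r.
rewrite -[leRHS]real_normK ?num_real// lerXn2r ?nnegrE ?ler0n//.
rewrite -intr_norm -[w.+1%:R]/((w.+1)%:Z%:~R) ler_int; lia.
Qed.

(** A walk that has to be back after [2 n] steps picks independently a point
    reached after [n] steps from each end; by Cauchy-Schwarz the coincidence
    probability is at least the inverse size of any window that holds half of
    the mass, and by Chebyshev a window of the order of the standard deviation
    does. *)
Lemma return_even p n : 0 <= p -> p + p <= 1 ->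
  (4 * (2 * Num.sqrt (4 * p * n%:R) + 1))^-1 <=
  iter (n + n) (walk p p) (delta_at 0) 0.
Proof.
move=> p0 p1; set y := Num.sqrt _.
have y0 : 0 <= y by exact: sqrtr_ge0.
have y2 : y ^+ 2 = 4 * p * n%:R by rewrite sqr_sqrtr// !mulr_ge0.
pose w := Num.truncn y.
have /andP[wy yw] : w%:R <= y < w.+1%:R by exact: truncn_itv.
pose m := w.*2.+1; pose z (i : 'I_m) : int := i%:Z - w%:Z.
pose f := iter n (walk p p) (delta_at 0).
have fE (i : 'I_m) : iter n (walk p p) (delta_at (z i)) 0 = f (z i).
  by rewrite iter_walk_refl subr0.
have f0 s : 0 <= f s by apply: iter_walk_ge0 => // t; rewrite ler0n.
have S1 : 2^-1 <= \sum_(i < m) f (z i).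
  have := @iter_walk_le p p n _ _ p0 p0 p1 (window_Chebyshev w) 0.
  rewrite iter_walk_sum; under eq_bigr do rewrite fE mul1r.
  apply: le_trans.
  rewrite (@eq_iter_walk _ _ _ _
    (fun s => 1 + (- w.+1%:R ^- 2) * s%:~R ^+ 2)); last first.
    by move=> s; rewrite mulNr mulrC.
  rewrite (iter_walk_affine _ _ _ _ _ (fun s => s%:~R ^+ 2)) iter_walk_sqr.
  rewrite expr0n add0r mulNr lerBrDr -lerBrDl.
  rewrite mulrC ler_pdivrMr ?exprn_gt0//.
  have : y ^+ 2 <= w.+1%:R ^+ 2 by apply: lerXn2r; rewrite ?nnegrE ?ler0n ?(ltW yw).
  rewrite y2; lra.
have S2 : \sum_(i < m) f (z i) * f (z i) <= iter (n + n) (walk p p) (delta_at 0) 0.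
  rewrite iterD -/f.
  under eq_bigr do rewrite -{2}fE.
  rewrite -iter_walk_sum; apply: iter_walk_le => // s.
  have [[i si]|nz] := pselect (exists i : 'I_m, s = z i).
    rewrite (bigD1 i)//= big1 ?addr0; first by rewrite si /delta_at eqxx mulr1.
    move=> j ji; rewrite /delta_at si; case: eqP => [|_]; last by rewrite mulr0.
    rewrite /z => /(congr1 (fun x => x + w%:Z)); rewrite !subrK => -[ij].
    by rewrite (val_inj ij) eqxx in ji.
  rewrite big1// => i _; rewrite /delta_at; case: eqP => [si|]; rewrite ?mulr0//.
  by case: nz; exists i.
apply: le_trans S2.
(* Cauchy-Schwarz in the form of a completed square, around the mean value *)
have m0 : 0 < m%:R :> R by rewrite ltr0n.
have CS (c : R) : 2 * c * (\sum_(i < m) f (z i)) - m%:R * c ^+ 2 <=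
    \sum_(i < m) f (z i) * f (z i).
  have -> : m%:R * c ^+ 2 = \sum_(i < m) c ^+ 2.
    by rewrite sumr_const card_ord mulr_natl.
  rewrite mulr_sumr -sumrB.
  apply: ler_sum => i _; rewrite -subr_ge0.
  have -> : f (z i) * f (z i) - (2 * c * f (z i) - c ^+ 2) =
    (f (z i) - c) ^+ 2 by ring.
  exact: sqr_ge0.
apply: le_trans (CS ((2 * m%:R)^-1)).
have mE : m%:R <= 2 * y + 1.
  by rewrite /m -addn1 -muln2 natrD natrM mulrC lerD2r ler_pM2l.
apply: (@le_trans _ _ ((4 * m%:R)^-1)).
  by rewrite lef_pV2 ?posrE ?mulr_gt0// ?ler_pM2l//; lra.
have mV : 0 < m%:R^-1 :> R by rewrite invr_gt0.
have -> : m%:R * (2 * m%:R)^-1 ^+ 2 = 4^-1 * m%:R^-1 :> R.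
  by field; rewrite gt_eqF.
rewrite !invfM.
have : 2^-1 * m%:R^-1 <= (\sum_(i < m) f (z i)) * m%:R^-1 by rewrite ler_pM2r.
lra.
Qed.

(** After an odd number of steps: the last one stays put with probability at
    least [1 / 2]. *)
Lemma return_lb p n : 0 <= p -> p <= 4^-1 ->
  (16 * (Num.sqrt (2 * p * n%:R) + 1))^-1 <= iter n (walk p p) (delta_at 0) 0.
Proof.
move=> p0 p1; have pp : p + p <= 1 by lra.
have Pe : (4 * (2 * Num.sqrt (4 * p * n./2%:R) + 1))^-1 <=
    iter (n./2 + n./2) (walk p p) (delta_at 0) 0 by exact: return_even.
have cmp : (8 * (Num.sqrt (2 * p * n%:R) + 1))^-1 <=
    (4 * (2 * Num.sqrt (4 * p * n./2%:R) + 1))^-1.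
  have s0 := sqrtr_ge0 (4 * p * n./2%:R).
  rewrite lef_pV2 ?posrE; [|by have := sqrtr_ge0 (2 * p * n%:R); lra|lra].
  have : Num.sqrt (4 * p * n./2%:R) <= Num.sqrt (2 * p * n%:R).
    rewrite ler_wsqrtr//.
    have -> : 4 * p * n./2%:R = 2 * p * (n./2.*2)%:R by rewrite -muln2 natrM; ring.
    by rewrite ler_wpM2l ?mulr_ge0// ler_nat; lia.
  lra.
have P0 m s : 0 <= iter m (walk p p) (delta_at 0) s.
  by apply: iter_walk_ge0 => // t; rewrite ler0n.
have half : (16 * (Num.sqrt (2 * p * n%:R) + 1))^-1 =
    2^-1 * (8 * (Num.sqrt (2 * p * n%:R) + 1))^-1.
  by rewrite -invfM mulrA -natrM.
have s0 := sqrtr_ge0 (2 * p * n%:R).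
have p8 : 0 <= (8 * (Num.sqrt (2 * p * n%:R) + 1))^-1 by rewrite invr_ge0; lra.
have key := le_trans cmp Pe.
have [nE|nE] : n = (n./2 + n./2).+1 \/ n = (n./2 + n./2)%N by lia.
  rewrite half [X in iter X _ _ _]nE iterS /walk.
  have := P0 (n./2 + n./2)%N (0 - 1); have := P0 (n./2 + n./2)%N (0 + 1).
  set A := iter _ _ _ (0 + 1); set B := iter _ _ _ (0 - 1).
  move: p8 key; set X := _^-1; set Y := iter _ _ _ 0.
  by move=> X0 XY A0 B0; nra.
by rewrite half [X in iter X _ _ _]nE; lra.
Qed.

(** The exponential tilt turns a walk conditioned to come back into a
    symmetric one: up- and down-steps get the common weight [sqrt (a * b)], and
    the total weight of a step drops to [1 - (sqrt b - sqrt a) ^+ 2]. *)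
Lemma iter_walk_tilt a b n (rho := 1 - (Num.sqrt b - Num.sqrt a) ^+ 2) :
  0 <= a -> 0 <= b -> 0 < rho ->
  iter n (walk a b) (delta_at 0) 0 =
  rho ^+ n * iter n (walk (Num.sqrt (a * b) / rho) (Num.sqrt (a * b) / rho))
               (delta_at 0) 0.
Proof.
move=> a0 b0 r0; set p := _ / rho.
have rhoE : rho = 1 - a - b + 2 * Num.sqrt (a * b).
  rewrite /rho sqrrB !sqr_sqrtr// sqrtrM// -mulr_natl; ring.
have pr : p * rho = Num.sqrt (a * b) by rewrite /p divfK// gt_eqF.
(* a walk with steps of one sign returns only by staying put throughout *)
have [ab0|abN0] := eqVneq (a * b) 0.
  have p0 : p = 0 by rewrite /p ab0 sqrtr0 mul0r.
  have rE : rho = 1 - a - b by rewrite rhoE ab0 sqrtr0 mulr0 addr0.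
  have -> : iter n (walk p p) (delta_at 0) 0 = 1.
    rewrite p0; elim: (n) => [|m IH] /=; first by rewrite /delta_at eqxx.
    by rewrite /walk IH !mul0r !subr0 add0r addr0 mulr1.
  rewrite mulr1 rE; move/eqP: ab0; rewrite mulf_eq0 => /orP[]/eqP ->.
    suff : forall s, 0 <= s -> iter n (walk 0 b) (delta_at 0) s =
        (1 - 0 - b) ^+ n * (s == 0)%:R.
      by move=> /(_ 0 (lexx _)) ->; rewrite eqxx mulr1.
    elim: n => [|m IH] s s0 /=; first by rewrite expr0 mul1r.
    rewrite /walk mul0r add0r IH// IH ?addr_ge0//.
    have -> : (s + 1 == 0) = false by lia.
    by rewrite !mulr0 addr0 mulrA -exprS.
  suff : forall s, s <= 0 -> iter n (walk a 0) (delta_at 0) s =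
      (1 - a - 0) ^+ n * (s == 0)%:R.
    by move=> /(_ 0 (lexx _)) ->; rewrite eqxx mulr1.
  elim: n => [|m IH] s s0 /=; first by rewrite expr0 mul1r.
  rewrite /walk mul0r addr0 IH; last by lia.
  have -> : (s - 1 == 0) = false by lia.
  by rewrite IH// !mulr0 add0r mulrA -exprS.
have a1 : 0 < a by rewrite lt_neqAle a0 andbT eq_sym; apply: contraNneq abN0 => ->; rewrite mul0r.
have b1 : 0 < b by rewrite lt_neqAle b0 andbT eq_sym; apply: contraNneq abN0 => ->; rewrite mulr0.
pose r := Num.sqrt a / Num.sqrt b.
have sa : Num.sqrt a != 0 by rewrite gt_eqF// sqrtr_gt0.
have sb : Num.sqrt b != 0 by rewrite gt_eqF// sqrtr_gt0.
have rN0 : r != 0 by rewrite mulf_neq0// invr_neq0.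
have ar : a * r^-1 = p * rho.
  by rewrite pr sqrtrM// /r invf_div mulrA -{1}(sqr_sqrtr a0); field.
have br : b * r = p * rho.
  by rewrite pr sqrtrM// /r -{1}(sqr_sqrtr b0); field.
suff E m s : iter m (walk a b) (delta_at 0) s =
    rho ^+ m * (r ^ s * iter m (walk p p) (delta_at 0) s).
  by rewrite E expr0z mul1r.
elim: m s => [|m IH] s.
  by rewrite /= expr0 mul1r /delta_at; case: eqP => [->|_]; rewrite ?mulr0// expr0z mul1r.
rewrite !iterS {1}/walk !IH /walk exprS.
have -> : r ^ (s - 1) = r ^ s * r^-1 by rewrite expfzDr.
have -> : r ^ (s + 1) = r ^ s * r by rewrite expfzDr.
have -> : 1 - a - b = rho - 2 * (p * rho) by rewrite pr rhoE; ring.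
set A := iter _ _ _ (s - 1); set B := iter _ _ _ s; set D := iter _ _ _ (s + 1).
transitivity (rho ^+ m * r ^ s * (a * r^-1 * A + (rho - 2 * (p * rho)) * B + b * r * D)).
  by ring.
by rewrite ar br; ring.
Qed.

Lemma return_ge a b d : 0 <= a -> 0 <= b -> a <= 8^-1 -> b <= 8^-1 ->
  (1 - (Num.sqrt b - Num.sqrt a) ^+ 2) ^+ d /
    (32 * (Num.sqrt (Num.sqrt (a * b) * d%:R) + 1)) <=
  iter d (walk a b) (delta_at 0) 0.
Proof.
move=> a0 b0 a8 b8.
set rho := 1 - _.
have ab8 : Num.sqrt (a * b) <= 8^-1.
  have -> : 8^-1 = Num.sqrt (8^-1 ^+ 2) :> R by rewrite sqrtr_sqr ger0_norm.
  by rewrite ler_wsqrtr// expr2 ler_pM.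
have ab0 := sqrtr_ge0 (a * b).
have rhoE : rho = 1 - a - b + 2 * Num.sqrt (a * b).
  by rewrite /rho sqrrB !sqr_sqrtr// sqrtrM// -mulr_natl; ring.
have rho2 : 2^-1 <= rho by rewrite rhoE; lra.
have r0 : 0 < rho by lra.
rewrite iter_walk_tilt// -/rho ler_wpM2l ?exprn_ge0 ?(ltW r0)//.
set p := _ / rho.
have p2 : p <= 2 * Num.sqrt (a * b).
  by rewrite /p ler_pdivrMr//; nra.
have p0 : 0 <= p by rewrite divr_ge0// (ltW r0).
apply: le_trans (return_lb d p0 _); last by lra.
rewrite lef_pV2 ?posrE ?mulr_gt0 ?ltr_wpDl ?sqrtr_ge0//.
have : Num.sqrt (2 * p * d%:R) <= 2 * Num.sqrt (Num.sqrt (a * b) * d%:R).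
  rewrite [leRHS](_ : _ = Num.sqrt (2 ^+ 2 * (Num.sqrt (a * b) * d%:R))).
    rewrite ler_wsqrtr// mulrA ler_wpM2r//; lra.
  by rewrite [RHS]sqrtrM// sqrtr_sqr ger0_norm.
have := sqrtr_ge0 (2 * p * d%:R); lra.
Qed.

End Walk.

(** * Random bijections compared with independent sampling *)

Section Factorials.
Variable R : realType.

(** Stirling's formula up to a polynomial factor. *)
Lemma fact_ge_pow (n : nat) : n%:R ^+ n <= n`!%:R * expR n%:R :> R.
Proof.
case: n => [|n]; first by rewrite expr0 expR0 mulr1.
rewrite mulrC -ler_pdivrMr ?ltr0n ?fact_gt0//.
apply: le_trans (expR_ge1Dxn n (ler0n R n.+1)).
by rewrite lerDr.
Qed.

Lemma fact_le_pow (n : nat) :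
  n`!%:R * expR n%:R <= expR 1 * n.+1%:R * n%:R ^+ n :> R.
Proof.
have e1 : 1 <= expR 1 :> R by rewrite -{1}(@expR0 R) ler_expR.
case: n => [|n]; first by rewrite fact0 expR0 expr0 !mulr1.
apply: (@le_trans _ _ (expR 1 * n.+1%:R * n.+1%:R ^+ n.+1)); last first.
  by rewrite ler_wpM2r ?exprn_ge0// ler_wpM2l ?ler_nat// ltW ?expR_gt0.
elim: n => [|n IH]; first by rewrite !mulr1 mul1r.
have n2 : 0 < n.+2%:R :> R by rewrite ltr0n.
have step : n.+1%:R ^+ n.+2 * expR 1 <= n.+2%:R ^+ n.+2 :> R.
  have -> : n.+1%:R = n.+2%:R * (1 - n.+2%:R^-1) :> R.
    by rewrite mulrBr mulr1 divff ?gt_eqF// -[n.+2%:R]natr1 addrK.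
  rewrite exprMn -mulrA ler_piMr ?exprn_ge0//.
  have -> : expR 1 = expR (n.+2%:R^-1) ^+ n.+2 :> R.
    by rewrite -expRM_natl mulfV ?gt_eqF.
  have r0 : 0 <= 1 - n.+2%:R^-1 :> R by rewrite subr_ge0 invf_le1// ler1n.
  rewrite -exprMn exprn_ile1// ?mulr_ge0 ?expR_ge0//.
  rewrite -ler_pdivlMr ?expR_gt0// div1r -expRN.
  exact: expR_ge1Dx.
rewrite factS natrM -[in expR _]natr1 expRD.
have -> : n.+2%:R * n.+1`!%:R * (expR n.+1%:R * expR 1) =
  n.+2%:R * (n.+1`!%:R * expR n.+1%:R) * expR 1 :> R by ring.
apply: (@le_trans _ _
    (n.+2%:R * (expR 1 * n.+1%:R * n.+1%:R ^+ n.+1) * expR 1)).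
  by rewrite ler_wpM2r ?expR_ge0// ler_wpM2l// ltW.
have -> : n.+2%:R * (expR 1 * n.+1%:R * n.+1%:R ^+ n.+1) * expR 1 =
  expR 1 * n.+2%:R * (n.+1%:R ^+ n.+2 * expR 1) :> R.
  by rewrite [in RHS]exprS; ring.
by rewrite ler_wpM2l// mulr_ge0 ?expR_ge0 ?ltW.
Qed.
End Factorials.

Definition matchings (A B : finType) : {set {ffun A -> B}} :=
  [set g : {ffun A -> B} | injectiveb g && [forall b, exists e, g e == b]].

Section Bijections.
Variables (A B T : finType).
Implicit Types (g : {ffun A -> B}) (t : A -> T) (f : {ffun B -> T}).

Lemma matching_inv g : g \in matchings A B ->
  exists h : B -> A, cancel g h /\ cancel h g.
Proof.
rewrite inE => /andP[/injectiveP gi /forallP gs].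
have gs' b : exists e, g e == b by apply/existsP; exact: gs.
exists (fun b => xchoose (gs' b)); split => [e|b].
  by apply: gi; apply/eqP; exact: (xchooseP (gs' (g e))).
by apply/eqP; exact: (xchooseP (gs' b)).
Qed.

Lemma matchings_card : #|A| = #|B| -> #|matchings A B| = (#|A|)`!.
Proof.
move=> AB; rewrite -ffactnn {1}AB -card_inj_ffuns; apply: eq_card => g.
rewrite !inE; case: injectiveP => //= gi; apply/forallP => b; apply/existsP.
have := inj_card_onto gi; rewrite AB leqnn => /(_ isT b)/codomP[e ->].
by exists e.
Qed.

(** Two such matchings differ by a permutation that preserves the fibres of
    [t], and a permutation of this kind is given by its restrictions to the
    fibres. *)
Lemma matchings_carrying t f :
  (#|[set g in matchings A B | [forall e, f (g e) == t e]]| <=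
   \prod_(tau : T) (#|[set e | t e == tau]|)`!)%N.
Proof.
set G := [set g in _ | _].
have [->|[g0]] := set_0Vmem G; first by rewrite cards0.
rewrite inE => /andP[/matching_inv[h [g0K hK]] /forallP fg0].
have th b : t (h b) = f b by rewrite -(eqP (fg0 (h b))) hK.
pose q (g : {ffun A -> B}) (tau : T) (e : A) : A :=
  if t e == tau then h (g e) else e.
have Gt g e : g \in G -> t (h (g e)) = t e.
  by rewrite inE th => /andP[_ /forallP/(_ e)/eqP].
have q_inj g tau : g \in G -> injective (q g tau).
  move=> gG e e'; rewrite /q.
  case: ifPn => te; case: ifPn => te' //.
  - move/(can_inj hK); move: gG; rewrite inE => /andP[].
    by rewrite inE => /andP[/injectiveP gi _] _; exact: gi.
  - by move=> E; move: te'; rewrite -E Gt ?te.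
  - by move=> E; move: te; rewrite E Gt ?te'.
pose P g tau : {perm A} :=
  if pselect (injective (q g tau)) is left i then perm i else 1%g.
have PE g tau e : g \in G -> P g tau e = q g tau e.
  move=> gG; rewrite /P; case: pselect => [i|[]]; last exact: q_inj.
  by rewrite permE.
pose Phi g : {ffun T -> {perm A}} := [ffun tau => P g tau].
pose F tau := [pred s | perm_on [set e | t e == tau] s].
rewrite -(@card_in_imset _ _ Phi); last first.
  move=> g g' gG g'G PP; apply/ffunP => e.
  apply: (can_inj hK); have := congr1 (fun s : {ffun T -> {perm A}} => s (t e) e) PP.
  by rewrite !ffunE !PE// /q eqxx.
apply: (@leq_trans #|family F|).
  apply/subset_leq_card/fintype.subsetP => _ /imsetP[g gG ->].
  apply/familyP => tau; rewrite ffunE; apply/fintype.subsetP => e.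
  by rewrite !inE PE// /q; case: ifPn; rewrite ?eqxx.
rewrite card_family foldrE big_map big_enum/=.
by apply: leq_prod => tau _; rewrite -card_perm; exact: eq_leq.
Qed.
End Bijections.

Section Averaging.
Variables (R : realType) (T : finType).

(** By exchangeability a uniformly random arrangement of the types [t] has the
    law of an independent sample from the empirical distribution of [t],
    conditioned on showing every type exactly as often as [t] does. By Stirling
    that event is only polynomially unlikely. *)
Lemma matchings_vs_iid (A B : finType) (t : A -> T) (F : {ffun B -> T} -> R)
    (H : {ffun A -> B} -> R)
    (mu : T -> R := fun tau => #|[set e | t e == tau]|%:R / #|A|%:R) :
  #|A| = #|B| -> (forall f, 0 <= F f) ->
  (forall g (f : {ffun B -> T}), g \in matchings A B -> (forall e, f (g e) = t e) -> H g <= F f) ->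
  \sum_(g in matchings A B) H g <=
    (#|A|)`!%:R * (expR 1 * #|A|.+1%:R) ^+ #|T| *
    \sum_(f : {ffun B -> T}) (\prod_b mu (f b)) * F f.
Proof.
move=> AB F0 HF.
pose n (tau : T) : nat := #|[set e | t e == tau]|.
pose K : R := (expR 1 * #|A|.+1%:R) ^+ #|T|.
pose C g (f : {ffun B -> T}) := [forall e, f (g e) == t e] : bool.
have mu0 tau : 0 <= mu tau by rewrite divr_ge0.
have nA : (\sum_tau n tau = #|A|)%N.
  rewrite -sum1_card (partition_big t predT)//=; apply: eq_bigr => tau _.
  by rewrite /n -sum1_card; apply: eq_bigl => e; rewrite inE.
have step1 : \sum_(g in matchings A B) H g <=
    \sum_(f : {ffun B -> T}) #|[set g in matchings A B | C g f]|%:R * F f.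
  have -> : \sum_(f : {ffun B -> T}) #|[set g in matchings A B | C g f]|%:R * F f =
      \sum_(g in matchings A B) \sum_(f : {ffun B -> T} | C g f) F f.
    rewrite (exchange_big_dep xpredT)//=; apply: eq_bigr => f _.
    rewrite -sum1_card natr_sum mulr_suml; apply: eq_big => [g|g _].
      by rewrite inE.
    by rewrite mul1r.
  apply: ler_sum => g gm; have [h [gK hK]] := matching_inv gm.
  have Cg : C g [ffun b => t (h b)].
    by apply/forallP => e; rewrite ffunE gK.
  rewrite (bigD1 _ Cg)/= ler_wpDr ?sumr_ge0//.
  by apply: HF => // e; exact/eqP/(forallP Cg).
apply: (le_trans step1); rewrite mulr_sumr; apply: ler_sum => f _.
rewrite mulrA ler_wpM2r//.
have [->|[g0]] := set_0Vmem [set g in matchings A B | C g f].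
  by rewrite cards0 mulr_ge0 ?mulr_ge0 ?exprn_ge0 ?mulr_ge0 ?expR_ge0 ?prodr_ge0.
rewrite inE => /andP[/matching_inv[h [gK hK]] /forallP g0f].
apply: (@le_trans _ _ (\prod_tau (n tau)`!)%:R).
  by rewrite ler_nat; exact: matchings_carrying.
have -> : \prod_b mu (f b) = \prod_tau mu tau ^+ n tau.
  rewrite (reindex g0)/=; last by exists h => ? _; [exact: gK|exact: hK].
  rewrite (partition_big t predT)//=; apply: eq_bigr => tau _.
  rewrite -[in RHS]prodr_const; apply: eq_big => [e|e /eqP <-]; first by rewrite inE.
  by rewrite (eqP (g0f e)).
have [A0|A0] := posnP #|A|.
  have n0 tau : n tau = 0%N.
    by apply/eqP; rewrite -leqn0 -A0 -nA (bigD1 tau)//= leq_addr.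
  rewrite !big1 ?mulr1; last 2 first.
  - by move=> tau _; rewrite n0.
  - by move=> tau _; rewrite n0.
  by rewrite A0 mul1r mulr1 exprn_ege1// -{1}(@expR0 R) ler_expR.
have Apos : 0 < #|A|%:R :> R by rewrite ltr0n.
rewrite -(ler_pM2r (expR_gt0 #|A|%:R)).
have -> : (\prod_tau (n tau)`!)%:R * expR #|A|%:R =
    \prod_tau ((n tau)`!%:R * expR (n tau)%:R) :> R.
  rewrite -nA natr_sum (big_morph _ (@expRD R) (@expR0 R)).
  by rewrite (big_morph (fun i : nat => i%:R : R) (id1 := 1) (op1 := *%R))
     -?big_split//; exact: natrM.
apply: (@le_trans _ _ (\prod_tau (expR 1 * #|A|.+1%:R * (n tau)%:R ^+ n tau))).
  apply: ler_prod => tau _; rewrite mulr_ge0 ?expR_ge0//=.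
  apply: (le_trans (fact_le_pow R (n tau))).
  by rewrite ler_wpM2r ?exprn_ge0// ler_wpM2l ?expR_ge0// ler_nat ltnS max_card.
rewrite big_split/= prodr_const -/K.
have -> : (#|A|)`!%:R * K * \prod_tau mu tau ^+ n tau * expR #|A|%:R =
    K * ((#|A|)`!%:R * expR #|A|%:R * \prod_tau mu tau ^+ n tau) by ring.
rewrite ler_wpM2l ?exprn_ge0 ?mulr_ge0 ?expR_ge0//.
have -> : \prod_tau (n tau)%:R ^+ n tau =
    #|A|%:R ^+ #|A| * \prod_tau mu tau ^+ n tau :> R.
  rewrite -[in X in _ ^+ X]nA -prodrXr -big_split/=; apply: eq_bigr => tau _.
  by rewrite -exprMn /mu mulrC divfK ?gt_eqF.
by rewrite ler_wpM2r ?fact_ge_pow// prodr_ge0// => tau _; rewrite exprn_ge0.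
Qed.

End Averaging.

Section IidSums.
Variable R : realType.

Lemma sum_ffun_recl (T : finType) d (G : {ffun 'I_d.+1 -> T} -> R) :
  \sum_h G h = \sum_(tau : T) \sum_(h : {ffun 'I_d -> T})
    G [ffun i => if unlift ord0 i is Some j then h j else tau].
Proof.
rewrite pair_big/=.
rewrite (reindex (fun p : T * {ffun 'I_d -> T} =>
  [ffun i => if unlift ord0 i is Some j then p.2 j else p.1]))//=.
exists (fun h => (h ord0, [ffun j => h (lift ord0 j)])) => [[tau h] _|h _].
  congr pair; first by rewrite ffunE unlift_none.
  by apply/ffunP => j; rewrite !ffunE liftK.
by apply/ffunP => i; rewrite !ffunE; case: unliftP => [j|] ->; rewrite ?ffunE.
Qed.

(** A step is coded by [0], [1] or [2], standing for [-1], [0] and [+1]. *)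
Definition step_law (a b : R) (tau : 'I_3) : R :=
  if tau == ord0 then a else if tau == ord_max then b else 1 - a - b.

Lemma iid_walk (a b : R) d (u : int -> R) s :
  \sum_(h : {ffun 'I_d -> 'I_3}) (\prod_i step_law a b (h i)) *
    u (s + (\sum_i h i)%N%:Z - d%:Z) = iter d (walk a b) u s.
Proof.
elim: d s => [|d IH] s.
  rewrite (bigD1 [ffun=> ord0])//= !big_ord0 mul1r big1 ?addr0 ?subr0//.
  by move=> h /eqP[]; apply/ffunP => -[].
rewrite sum_ffun_recl.
transitivity (\sum_(tau : 'I_3) step_law a b tau *
    iter d (walk a b) u (s + (tau%:Z - 1))).
  apply: eq_bigr => tau _; rewrite -IH mulr_sumr; apply: eq_bigr => h _.
  set h' := finfun _.
  have h'0 : h' ord0 = tau by rewrite ffunE unlift_none.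
  have h'l i : h' (lift ord0 i) = h i by rewrite ffunE liftK.
  rewrite !big_ord_recl !h'0 -mulrA; congr (_ * (_ * u _)).
    by apply: eq_bigr => i _; rewrite h'l.
  have -> : (\sum_(i < d) h' (lift ord0 i) = \sum_i h i)%N.
    by apply: eq_bigr => i _; rewrite h'l.
  by rewrite PoszD -[d.+1]addn1 (PoszD d); ring.
rewrite !big_ord_recl big_ord0 iterS [RHS]/walk /step_law /= /bump /= !addr0 addrA.
by congr (_ + _ + _); congr (_ * iter _ _ _ _); lia.
Qed.

Lemma sum_ffun_curry (T : finType) m d (G : {ffun 'I_m * 'I_d -> T} -> R) :
  \sum_f G f =
  \sum_(F : {ffun 'I_m -> {ffun 'I_d -> T}}) G [ffun b => F b.1 b.2].
Proof.
rewrite (reindex (fun F : {ffun 'I_m -> {ffun 'I_d -> T}} =>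
  [ffun b : 'I_m * 'I_d => F b.1 b.2]))//=.
exists (fun f => [ffun v => [ffun i => f (v, i)]]) => [F _|f _].
  by apply/ffunP => v; apply/ffunP => i; rewrite !ffunE.
by apply/ffunP => -[v i]; rewrite !ffunE.
Qed.

(** The types at the half-edges of distinct variables are independent. *)
Lemma iid_product (T : finType) N d (mu : T -> R) (w : 'I_N -> nat -> R)
    (val : T -> nat) :
  \sum_(f : {ffun 'I_N * 'I_d -> T}) (\prod_b mu (f b)) *
      \prod_v w v (\sum_i val (f (v, i)))%N =
  \prod_v \sum_(h : {ffun 'I_d -> T}) (\prod_i mu (h i)) *
      w v (\sum_i val (h i))%N.
Proof.
rewrite bigA_distr_bigA sum_ffun_curry/=.
apply: eq_bigr => F _; rewrite big_split/=; congr (_ * _).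
  by rewrite pair_bigA/=; apply: eq_bigr => -[v i] _; rewrite ffunE.
apply: eq_bigr => v _; congr (w v _); apply: eq_bigr => i _.
by rewrite ffunE.
Qed.

Lemma sum_prod_zeros N (y : R) :
  \sum_(x : {ffun 'I_N -> bool}) \prod_v (if x v then 1 else y) = (1 + y) ^+ N.
Proof.
rewrite -(bigA_distr_bigA (fun _ (c : bool) => if c then 1 else y))/=.
by rewrite (eq_bigr (fun=> 1 + y)) ?prodr_const ?card_ord// => i _; rewrite big_bool.
Qed.

End IidSums.

(** * Minimizers with the most ones *)

Section LocalOptimality.
Variables (N M d k : nat).
Local Notation edge := ('I_M * 'I_k)%type.
Local Notation slot := ('I_N * 'I_d)%type.
Implicit Types (g : {ffun edge -> slot}) (l : {ffun edge -> bool}) (e : edge)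
  (x : {ffun 'I_N -> bool}) (v : 'I_N) (a : 'I_M) (G : configuration N M d k).

Definition all_equal l a : bool :=
  [forall i : 'I_k, forall j : 'I_k, l (a, i) == l (a, j)].

Definition critical l e : bool :=
  [forall i : 'I_k, (i != e.2) ==> (l (e.1, i) != l e)].

(** One more than the change in the number of violated clauses when the
    literal at [e] alone is negated. *)
Definition edge_type l e : 'I_3 :=
  if all_equal l e.1 then ord0 else if critical l e then ord_max else inord 1.

Definition num_all_equal l : nat := #|[set a | all_equal l a]|.

Definition literals G x : {ffun edge -> bool} :=
  [ffun e => literal G x e.1 e.2].

(** A variable that some clause meets twice; the types of its edges do not
    determine the effect of flipping it. *)
Definition doubled g v : bool :=
  [exists e : edge, exists f : edge,
    [&& e != f, e.1 == f.1, (g e).1 == v & (g f).1 == v]].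

Definition local_sum g l v : nat := \sum_(e | (g e).1 == v) edge_type l e.

Definition flip x v : {ffun 'I_N -> bool} := [ffun u => x u (+) (u == v)].

Lemma violatedE G x a : violated G x a = all_equal (literals G x) a.
Proof.
by apply/forallP/forallP => h i; apply/forallP => j;
  have /forallP/(_ j) := h i; rewrite !ffunE.
Qed.

Lemma num_violatedE G x : num_violated G x = num_all_equal (literals G x).
Proof. by apply: eq_card => a; rewrite !inE violatedE. Qed.

Lemma literals_flip G x v e :
  literals G (flip x v) e = literals G x e (+) ((G.1 e).1 == v).
Proof. by case: e => a i; rewrite !ffunE /literal ffunE addbA. Qed.

Lemma degree g v : g \in matchings _ _ -> (\sum_(e | (g e).1 == v) 1 = d)%N.
Proof.
move=> /matching_inv[h [gK hK]].
rewrite (reindex h)/=; last by exists g => ? _; [exact: hK|exact: gK].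
transitivity (\sum_(b : slot | b.1 == v) 1)%N.
  by apply: eq_bigl => b; rewrite hK.
transitivity (\sum_(u | u == v) \sum_(i < d) 1)%N.
  by rewrite pair_big_dep/=; apply: eq_bigl => b; rewrite andbT.
by rewrite big_pred1_eq sum_nat_const card_ord muln1.
Qed.

(** A variable that is not doubled meets each clause in at most one edge, so
    the change in energy is the sum of the contributions of its edges. *)
Lemma flip_le G x v : (1 < k)%N -> G.1 \in matchings _ _ ->
  ~~ doubled G.1 v -> (local_sum G.1 (literals G x) v <= d)%N ->
  (num_violated G (flip x v) <= num_violated G x)%N.
Proof.
move=> k1 Gm /existsPn nd ls; set l := literals G x; set l' := literals G (flip x v).
suff clause a : (all_equal l' a + \sum_(e | (e.1 == a) && ((G.1 e).1 == v)) 1 <=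
    all_equal l a + \sum_(e | (e.1 == a) && ((G.1 e).1 == v)) edge_type l e)%N.
  have split (F : edge -> nat) : (\sum_(e | (G.1 e).1 == v) F e =
      \sum_a \sum_(e | (e.1 == a) && ((G.1 e).1 == v)) F e)%N.
    rewrite (partition_big (fun e => e.1) predT)//=.
    by apply: eq_bigr => a _; apply: eq_bigl => e; rewrite andbC.
  have count m : num_all_equal m = (\sum_a all_equal m a)%N.
    rewrite /num_all_equal -sum1_card big_mkcond/=; apply: eq_bigr => a _.
    by rewrite inE; case: all_equal.
  rewrite !num_violatedE -/l -/l' -(leq_add2r d).
  apply: leq_trans (leq_add (leqnn _) ls); rewrite -{1}(degree v Gm) /local_sum !split.
  by rewrite !count -!big_split/=; exact: leq_sum.
have l'E e : l' e = l e (+) ((G.1 e).1 == v) by exact: literals_flip.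
have [[e /andP[/eqP ea /eqP ev]]|none] :=
  pselect (exists e, (e.1 == a) && ((G.1 e).1 == v)); last first.
  rewrite !big_pred0 => [|e|e]; last 2 first.
  - by apply/negbTE/negP => h; apply: none; exists e.
  - by apply/negbTE/negP => h; apply: none; exists e.
  rewrite !addn0; have -> // : all_equal l' a = all_equal l a.
  have l'l i : l' (a, i) = l (a, i).
    rewrite l'E; case: eqP => [h|_]; rewrite ?addbF//.
    by case: none; exists (a, i); rewrite /= h !eqxx.
  by apply: eq_forallb => i; apply: eq_forallb => j; rewrite !l'l.
have only f : ((f.1 == a) && ((G.1 f).1 == v)) = (f == e).
  apply/idP/eqP => [/andP[/eqP fa /eqP fv]|->]; last by rewrite ea ev !eqxx.
  apply/eqP/negPn/negP => fe.
  by have /existsPn/(_ f) := nd e; rewrite eq_sym fe ea fa ev fv !eqxx.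
rewrite !(eq_bigl _ _ only) !big_pred1_eq /edge_type ea.
have l'N i : i != e.2 -> l' (a, i) = l (a, i).
  move=> ie; rewrite l'E; case: eqP => [h|_]; rewrite ?addbF//.
  by have := only (a, i); rewrite /= h !eqxx => /esym/eqP h'; rewrite -h' eqxx in ie.
have l'e : l' e = ~~ l e by rewrite l'E ev eqxx addbT.
have eE : e = (a, e.2) by rewrite -ea -surjective_pairing.
have crit : all_equal l' a -> critical l e.
  move=> /forallP h; apply/forallP => i; apply/implyP => ie.
  have /forallP/(_ e.2)/eqP := h i; rewrite -eE l'e l'N// ea => ->.
  by case: (l e).
case: ifPn => la.
  have [i ie] : exists i : 'I_k, i != e.2.
    have k0 : (0 < k)%N by exact: ltnW.
    have [e0|e0] := eqVneq e.2 (Ordinal k0); last by exists (Ordinal k0); rewrite eq_sym.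
    by exists (Ordinal k1); rewrite e0.
  rewrite (_ : all_equal l' a = false)//; apply/negP => /crit/forallP/(_ i).
  rewrite ie/= ea; have /forallP/(_ i)/forallP/(_ e.2) := la.
  by rewrite -eE => ->.
case: ifPn => lc; first by rewrite addn1; case: all_equal.
rewrite inordK// (_ : all_equal l' a = false)//.
by apply/negP => /crit; exact/negP.
Qed.

(** Among the minimizers, one with the most ones: turning a zero into a one
    has to violate strictly more clauses. *)
Lemma extremal_minimizer G : (1 < k)%N -> G.1 \in matchings _ _ ->
  exists2 x, num_violated G x = min_violated G &
    forall v, ~~ x v -> doubled G.1 v \/ (d < local_sum G.1 (literals G x) v)%N.
Proof.
move=> k1 Gm; have [[x0 x0m] le_min] := min_violatedP G.
pose P x := num_violated G x == min_violated G.
have Px0 : P x0 by apply/eqP.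
have [x /eqP xm xmax] := arg_maxnP (fun x => #|[set u | x u]|) Px0.
exists x => // v xv.
have [|nd] := boolP (doubled G.1 v); [by left|right].
rewrite ltnNge; apply/negP => /(flip_le k1 Gm nd); rewrite xm => le.
have Pf : P (flip x v) by rewrite /P eqn_leq le le_min.
have := xmax _ Pf; rewrite /geq/= leqNgt => /negP[].
rewrite (_ : [set u | flip x v u] = v |: [set u | x u]); last first.
  apply/setP => u; rewrite !inE ffunE; case: eqP => [->|_]; last by rewrite addbF.
  by rewrite (negbTE xv).
by rewrite cardsU1 inE xv.
Qed.

Variable R : realType.

(** The weight of a zero that violates the constraint is [1 / 2] instead of [0]:
    doubled variables may violate it, at the price of a factor [2] each. *)
Definition zero_weight (s : nat) : R := if (s <= d)%N then 2^-1 else 1.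

(** Union bound over the assignments, each of them a candidate extremal
    minimizer. *)
Lemma few_violations (E : R) (D : nat) : (1 < k)%N ->
  #|[set G in instances N M d k | ((min_violated G)%:R <= E) &&
      (#|[set v | doubled G.1 v]| <= D)%N]|%:R <=
  2 ^+ D * \sum_(l : {ffun edge -> bool} | (num_all_equal l)%:R <= E)
    \sum_(g in matchings edge slot) \sum_(x : {ffun 'I_N -> bool})
      \prod_v (if x v then 1 else zero_weight (local_sum g l v)).
Proof.
move=> k1.
pose W g l x : R := \prod_v (if x v then 1 else zero_weight (local_sum g l v)).
have w0 s : 0 <= zero_weight s by rewrite /zero_weight; case: ifP.
have W0 g l x : 0 <= W g l x by apply: prodr_ge0 => v _; case: (x v).
have bound G : G \in instances N M d k -> (min_violated G)%:R <= E ->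
    (#|[set v | doubled G.1 v]| <= D)%N ->
    1 <= 2 ^+ D * \sum_(x | (num_all_equal (literals G x))%:R <= E)
           W G.1 (literals G x) x.
  move=> Gi GE GD; have Gm : G.1 \in matchings edge slot by move: Gi; rewrite !inE.
  have [x xm xo] := extremal_minimizer k1 Gm.
  rewrite (bigD1 x)/=; last by rewrite -num_violatedE xm.
  rewrite mulrDr ler_wpDr ?mulr_ge0 ?exprn_ge0 ?sumr_ge0//.
  rewrite -ler_pdivrMl ?exprn_gt0// mulr1.
  apply: (@le_trans _ _ (\prod_v (if doubled G.1 v then 2^-1 else 1))).
    rewrite -big_mkcond/= prodr_const -exprVn.
    apply: ler_wiXn2l; rewrite ?invr_ge0 ?invf_le1//; first by rewrite ler1n.
    by apply: leq_trans GD; apply: eq_leq; apply: eq_card => v; rewrite inE.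
  apply: ler_prod => v _; apply/andP; split; first by case: ifP.
  have [xv|xv] := boolP (x v); first by case: ifP => //; rewrite invf_le1// ler1n.
  rewrite /zero_weight; case: (xo v xv) => [->|].
    by case: ifP => // _; rewrite invf_le1// ler1n.
  by rewrite ltnNge => /negbTE ->; case: ifP => //; rewrite invf_le1// ler1n.
apply: (@le_trans _ _ (\sum_(G in instances N M d k)
    2 ^+ D * \sum_(x | (num_all_equal (literals G x))%:R <= E)
           W G.1 (literals G x) x)).
  rewrite -sum1_card natr_sum [leRHS](bigID (fun G =>
    ((min_violated G)%:R <= E) && (#|[set v | doubled G.1 v]| <= D)%N))/=.
  rewrite ler_wpDr//; first by apply: sumr_ge0 => G _; rewrite mulr_ge0 ?exprn_ge0 ?sumr_ge0.
  rewrite big_mkcond [leRHS]big_mkcond/=; apply: ler_sum => G _.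
  rewrite inE; case: ifP => // /andP[Gi /andP[GE GD]].
  exact: bound.
rewrite -mulr_sumr ler_wpM2l ?exprn_ge0//.
rewrite (exchange_big_dep xpredT)//=.
have -> : \sum_(l : {ffun edge -> bool} | (num_all_equal l)%:R <= E)
    \sum_(g in matchings edge slot) \sum_(x : {ffun 'I_N -> bool}) W g l x =
  \sum_(x : {ffun 'I_N -> bool}) \sum_(g in matchings edge slot)
    \sum_(l : {ffun edge -> bool} | (num_all_equal l)%:R <= E) W g l x.
  rewrite exchange_big/= [RHS]exchange_big/=; apply: eq_bigr => g _.
  by rewrite exchange_big.
rewrite le_eqVlt; apply/orP; left; apply/eqP; apply: eq_bigr => x _.
rewrite pair_big_dep/=.
(* for a given assignment, labels and literals determine each other *)
pose tr (p : {ffun edge -> slot} * {ffun edge -> bool}) : configuration N M d k :=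
  (p.1, [ffun e => p.2 e (+) x (p.1 e).1]).
have trE p : literals (tr p) x = p.2.
  by apply/ffunP => -[a i]; rewrite !ffunE /literal /tr/= ffunE -addbA addbb addbF.
rewrite (reindex tr)/=; last first.
  exists (fun G => (G.1, literals G x)) => [[g l] _|[g L] _].
    by congr pair; exact: trE.
  congr pair; apply/ffunP => -[a i].
  by rewrite !ffunE /literal/= -addbA addbb addbF.
apply: eq_big => [p|p _]; rewrite trE//.
by rewrite !inE.
Qed.
End LocalOptimality.

(** * Average over the matching *)

Section MatchingAverage.
Variables (N M d k : nat).
Local Notation edge := ('I_M * 'I_k)%type.
Local Notation slot := ('I_N * 'I_d)%type.
Implicit Types (g : {ffun edge -> slot}) (l : {ffun edge -> bool}) (e f : edge)
  (v : 'I_N).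

Lemma card_instances_pred (P : pred {ffun edge -> slot}) :
  #|[set G in instances N M d k | P G.1]| =
  (#|[set g in matchings edge slot | P g]| * 2 ^ (M * k))%N.
Proof.
have -> : [set G in instances N M d k | P G.1] =
    finset.setX [set g in matchings edge slot | P g] [set: {ffun edge -> bool}].
  by apply/setP => -[g L]; rewrite !inE andbT.
by rewrite cardsX cardsT card_ffun card_bool card_prod !card_ord.
Qed.

(** Two given edges meet at a variable with probability at most [1 / N]: all
    the edges other than [e] are equally likely to do so with [e], and exactly
    [d - 1] of them do. *)
Lemma collision_le e f : e != f -> (M * k = N * d)%N ->
  (N * #|[set g in matchings edge slot | (g e).1 == (g f).1]| <=
   #|matchings edge slot|)%N.
Proof.
move=> ef MkNd; pose T f' := #|[set g in matchings edge slot | (g e).1 == (g f').1]|.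
have Tmin f' : f' != e -> (T f <= T f')%N.
  move=> f'e; pose sw g : {ffun edge -> slot} := [ffun c => g (tperm f f' c)].
  have swK : involutive sw by move=> g; apply/ffunP => c; rewrite !ffunE tpermK.
  rewrite /T -(card_imset _ (inv_inj swK)); apply/subset_leq_card.
  apply/fintype.subsetP => g' /imsetP[g]; rewrite inE => /andP[gm ge] ->.
  have fe : f != e by rewrite eq_sym.
  rewrite inE !ffunE tpermR tpermD// ge andbT.
  move: gm; rewrite !inE => /andP[gi gs]; apply/andP; split.
    apply/injectiveP => c c'; rewrite !ffunE => /(injectiveP _ gi).
    exact: perm_inj.
  apply/forallP => b; have /forallP/(_ b)/existsP[c gc] := gs.
  by apply/existsP; exists (tperm f f' c); rewrite ffunE tpermK.
have Tsum : (\sum_(f' | f' != e) T f' = #|matchings edge slot| * d.-1)%N.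
  under eq_bigr => f' _ do rewrite /T -sum1_card.
  rewrite -sum_nat_const (exchange_big_dep (mem (matchings edge slot)))/=; last first.
    by move=> f' g _; rewrite inE => /andP[].
  apply: eq_bigr => g gm; have dg := degree (g e).1 gm.
  rewrite (bigD1 e)//= add1n in dg; rewrite -[RHS](congr1 predn dg)/=.
  by apply: eq_bigl => f'; rewrite inE gm/= andbC eq_sym.
have [n0|n0] := posnP N; first by rewrite n0.
have card_e : #|[pred f' | f' != e]| = (N * d).-1.
  by rewrite -MkNd -[M in RHS]card_ord -[k in RHS]card_ord -card_prod (cardC1 e).
have {}Tsum : ((N * d).-1 * T f <= #|matchings edge slot| * d.-1)%N.
  by rewrite -Tsum -card_e -sum_nat_const; exact: leq_sum.
have d1 : (d = d.-1.+1)%N.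
  have : (0 < M * k)%N.
    by rewrite muln_gt0 (leq_ltn_trans _ (ltn_ord e.1))// (leq_ltn_trans _ (ltn_ord e.2)).
  by rewrite MkNd muln_gt0 => /andP[_ d0]; rewrite prednK.
have {}Tsum : ((N * d).-1 * (N * T f) <= (N * d).-1 * #|matchings edge slot|)%N.
  rewrite mulnCA; apply: leq_trans (leq_mul (leqnn N) Tsum) _.
  by rewrite mulnCA [leqRHS]mulnC leq_mul2l; apply/orP; right; nia.
have : (0 < (N * d).-1)%N.
  by rewrite -card_e; apply/card_gt0P; exists f; rewrite inE eq_sym.
by move=> /leq_pmul2l <-.
Qed.

(** Markov's inequality for the number of pairs of edges that join the same
    clause to the same variable. *)
Lemma doubled_rare (D : nat) : (M * k = N * d)%N ->
  (D.+1 * #|[set G in instances N M d k | (D < #|[set v | doubled G.1 v]|)%N]| <=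
   d * k * #|instances N M d k|)%N.
Proof.
move=> MkNd.
rewrite (card_instances_pred (fun g => D < #|[set v | doubled g v]|)%N).
have -> : #|instances N M d k| = (#|matchings edge slot| * 2 ^ (M * k))%N.
  have := card_instances_pred predT.
  rewrite (_ : [set G in _ | predT G.1] = instances N M d k); last first.
    by apply/setP => G; rewrite inE andbT.
  rewrite (_ : [set g in _ | predT g] = matchings edge slot)//.
  by apply/setP => g; rewrite inE andbT.
rewrite !mulnA leq_mul2r; apply/orP; right.
have [N0|N0] := posnP N.
  rewrite (_ : [set g in matchings edge slot | _] = finset.set0) ?cards0 ?muln0//.
  apply/setP => g; rewrite !inE; apply/negbTE; rewrite negb_and -leqNgt.
  apply/orP; right; apply: leq_trans (max_card _) _.
  by rewrite card_ord N0.
pose close (p : edge * edge) := (p.1 != p.2) && (p.1.1 == p.2.1).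
have card_close : (#|[set p | close p]| <= M * k * k)%N.
  pose c (p : edge * edge) := (p.1, p.2.2).
  rewrite -(@card_in_imset _ _ c); last first.
    move=> [[a i] [a' i']] [[b j] [b' j']]; rewrite !inE /close /c/=.
    by move=> /andP[_ /eqP ->] /andP[_ /eqP ->] [-> -> ->].
  by apply: leq_trans (max_card _) _; rewrite !card_prod !card_ord.
have dbl g : (#|[set v | doubled g v]| <=
    \sum_(p | close p) ((g p.1).1 == (g p.2).1))%N.
  have wit v : doubled g v -> exists p : edge * edge,
      close p && ((g p.1).1 == v) && ((g p.2).1 == v).
    move=> /existsP[c /existsP[c' /and4P[h1 h2 h3 h4]]].
    by exists (c, c'); rewrite /close h1 h2 h3 h4.
  have -> : (\sum_(p | close p) ((g p.1).1 == (g p.2).1) =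
      \sum_v #|[set p | close p && ((g p.1).1 == v) && ((g p.2).1 == v)]|)%N.
    rewrite (partition_big (fun p => (g p.1).1) predT)//=; apply: eq_bigr => v _.
    rewrite -sum1_card big_mkcond [RHS]big_mkcond/=; apply: eq_bigr => p _.
    rewrite inE; case: eqP => [->|_]; rewrite ?andbF ?andbT//=.
    by case: (close p) => //=; rewrite eq_sym; case: eqP.
  rewrite -sum1_card big_mkcond/=; apply: leq_sum => v _.
  rewrite inE; case: ifP => // /wit[p hp].
  by apply/card_gt0P; exists p; rewrite inE.
have total : (N * \sum_(g in matchings edge slot) #|[set v | doubled g v]| <=
    N * (d * k * #|matchings edge slot|))%N.
  apply: (@leq_trans (N * \sum_(g in matchings edge slot)
     \sum_(p | close p) ((g p.1).1 == (g p.2).1))).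
    by rewrite leq_mul2l; apply/orP; right; apply: leq_sum => g _; exact: dbl.
  rewrite exchange_big/= big_distrr/=.
  apply: (@leq_trans (\sum_(p | close p) #|matchings edge slot|)).
    apply: leq_sum => p /andP[pN _].
    apply: leq_trans (collision_le pN MkNd); rewrite leq_mul2l; apply/orP; right.
    rewrite -sum1_card big_mkcond [leqRHS]big_mkcond/=; apply: leq_sum => g _.
    by case: ifPn => // gm; case: eqP => // h; rewrite inE gm h eqxx.
  rewrite sum_nat_const; apply: (@leq_trans (M * k * k * #|matchings edge slot|)).
    rewrite leq_mul2r; apply/orP; right; apply: leq_trans card_close.
    by apply: eq_leq; apply: eq_card => p; rewrite inE.
  by rewrite MkNd !mulnA.
move: total; rewrite leq_pmul2l// => total; apply: leq_trans total.
rewrite mulnC -sum_nat_const big_mkcond [leqRHS]big_mkcond/=.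
apply: leq_sum => g _; rewrite inE.
by case: ifP => // /andP[-> ].
Qed.

Variable R : realType.
Implicit Types a b : R.

Definition type_freq l (tau : 'I_3) : R :=
  #|[set e | edge_type l e == tau]|%:R / #|{: edge}|%:R.

Lemma type_freqE l : (0 < #|{: edge}|)%N ->
  type_freq l =1 step_law (type_freq l ord0) (type_freq l ord_max).
Proof.
move=> n0 tau; rewrite /step_law; case: eqP => [->//|t0]; case: eqP => [->//|t2].
have n1 : #|{: edge}|%:R != 0 :> R by rewrite pnatr_eq0 -lt0n.
have S1 : \sum_tau type_freq l tau = 1.
  rewrite -mulr_suml -natr_sum.
  have -> : (\sum_tau #|[set e | edge_type l e == tau]| = #|{: edge}|)%N.
    rewrite -[RHS]sum1_card (partition_big (edge_type l) predT)//=.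
    apply: eq_bigr => s _; rewrite -sum1_card.
    by apply: eq_bigl => e; rewrite inE.
  by rewrite divff.
have -> : tau = lift ord0 ord0.
  apply: val_inj; case: tau t0 t2 => -[|[|[|//]]]//= h.
    by move=> t0; case: t0; exact: val_inj.
  by move=> _ t2; case: t2; exact: val_inj.
rewrite -S1 !big_ord_recl big_ord0.
have -> : lift ord0 (lift ord0 ord0) = ord_max :> 'I_3 by exact: val_inj.
ring.
Qed.

(** Zeros and ones of the assignment contribute [1 - g / 2] and [1] per variable,
    where the return probability [g] bounds from below, by monotonicity, the
    probability that a zero violates the constraint. *)
Lemma matching_average l a b : (M * k = N * d)%N -> (0 < #|{: edge}|)%N ->
  0 <= a -> a <= type_freq l ord0 -> type_freq l ord_max <= b -> a + b <= 1 ->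
  \sum_(g in matchings edge slot) \sum_(x : {ffun 'I_N -> bool})
    \prod_v (if x v then 1 else zero_weight d R (local_sum g l v)) <=
  (#|{: edge}|)`!%:R * (expR 1 * #|{: edge}|.+1%:R) ^+ 3 *
    (2 - iter d (walk a b) (delta_at R 0) 0 / 2) ^+ N.
Proof.
move=> MkNd n0 a0 al bl ab.
have AB : #|{: edge}| = #|{: slot}| by rewrite !card_prod !card_ord.
pose ff (f : {ffun slot -> 'I_3}) v := (\sum_i f (v, i))%N.
pose F (f : {ffun slot -> 'I_3}) : R := \sum_(x : {ffun 'I_N -> bool})
    \prod_v (if x v then 1 else zero_weight d R (ff f v)).
have w0 s : 0 <= zero_weight d R s by rewrite /zero_weight; case: ifP.
apply: (le_trans (@matchings_vs_iid R _ _ _ (edge_type l) F _ AB _ _)).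
- by move=> f; apply: sumr_ge0 => x _; apply: prodr_ge0 => v _; case: (x v).
- move=> g f gm fg; apply: ler_sum => x _; apply: ler_prod => v _.
  have -> : local_sum g l v = ff f v.
    rewrite /local_sum; under eq_bigr do rewrite -fg.
    have [h [gK hK]] := matching_inv gm.
    rewrite (reindex h)/=; last by exists g => ? _; [exact: hK|exact: gK].
    transitivity (\sum_(u | u == v) \sum_(i < d) f (u, i))%N.
      rewrite pair_big_dep/=; apply: eq_big => [p|[u i] _]; last by rewrite hK.
      by rewrite hK andbT.
    by rewrite big_pred1_eq.
  by rewrite lexx andbT; case: (x v).
rewrite card_ord ler_wpM2l ?mulr_ge0 ?exprn_ge0 ?mulr_ge0 ?expR_ge0//.
pose alpha := type_freq l ord0; pose beta := type_freq l ord_max.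
pose y := \sum_(h : {ffun 'I_d -> 'I_3}) (\prod_i type_freq l (h i)) *
  zero_weight d R (\sum_i h i)%N.
have al0 : 0 <= alpha by rewrite divr_ge0.
have be0 : 0 <= beta by rewrite divr_ge0.
have abl : alpha + beta <= 1.
  have := type_freqE l n0 (lift ord0 ord0); rewrite /step_law/= -/alpha -/beta.
  by move=> E; rewrite -subr_ge0 opprD addrA -E divr_ge0.
have fE (u : int -> R) : \sum_(h : {ffun 'I_d -> 'I_3})
    (\prod_i type_freq l (h i)) * u ((\sum_i h i)%N%:Z - d%:Z) =
    iter d (walk alpha beta) u 0.
  rewrite -iid_walk; apply: eq_bigr => h _; rewrite add0r; congr (_ * _).
  by apply: eq_bigr => i _; rewrite type_freqE.
have prod_y (x : {ffun 'I_N -> bool}) :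
    \sum_(f : {ffun slot -> 'I_3}) (\prod_b type_freq l (f b)) *
      \prod_v (if x v then 1 else zero_weight d R (ff f v)) =
    \prod_v (if x v then 1 else y).
  rewrite (iid_product _ (type_freq l)
    (fun v s => if x v then 1 else zero_weight d R s) (fun tau => tau : nat)).
  apply: eq_bigr => v _; case: (x v) => //.
  by rewrite (fE (fun=> 1)) iter_walk_const.
have -> : \sum_(f : {ffun slot -> 'I_3}) (\prod_b type_freq l (f b)) * F f =
    (1 + y) ^+ N.
  under eq_bigr do rewrite mulr_sumr.
  rewrite exchange_big/= -sum_prod_zeros; apply: eq_bigr => x _.
  exact: prod_y.
have yE : y = 1 - iter d (walk alpha beta) (fun s => (s <= 0)%R%:R) 0 / 2.
  rewrite [X in 1 - X]mulrC -mulNr -iter_walk_affine -fE; apply: eq_bigr => h _; congr (_ * _).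
  rewrite /zero_weight subr_le0 lez_nat; case: ifP => _; last by rewrite mulr0 addr0.
  by rewrite mulr1; field.
have low : iter d (walk a b) (delta_at R 0) 0 <=
    iter d (walk alpha beta) (fun s => (s <= 0)%R%:R) 0.
  have b0 : 0 <= b by exact: le_trans bl.
  apply: (@le_trans _ _ (iter d (walk a b) (fun s => (s <= 0)%R%:R) 0)).
    apply: iter_walk_le => // s; rewrite /delta_at ler_nat.
    by case: eqP => [->|].
  apply: iter_walk_mono => // s; rewrite ler_nat.
  by case: (leP (s + 1) 0) => // s1; rewrite (_ : s <= 0) //; lia.
have top : iter d (walk alpha beta) (fun s => (s <= 0)%R%:R) 0 <= 1 :> R.
  rewrite -[leRHS](@iter_walk_const R alpha beta d 1 0); apply: iter_walk_le => // s.
  by case: (_ <= 0).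
by rewrite yE; apply: lerXn2r; rewrite ?nnegrE; lra.
Qed.

Lemma matching_average_trivial l : (M * k = N * d)%N ->
  \sum_(g in matchings edge slot) \sum_(x : {ffun 'I_N -> bool})
    \prod_v (if x v then 1 else zero_weight d R (local_sum g l v)) <=
  (#|{: edge}|)`!%:R * 2 ^+ N.
Proof.
move=> MkNd.
have AB : #|{: edge}| = #|{: slot}| by rewrite !card_prod !card_ord.
rewrite -(matchings_card AB) mulr_natl -sumr_const; apply: ler_sum => g _.
have -> : 2 ^+ N = \sum_(x : {ffun 'I_N -> bool}) 1 :> R.
  by rewrite sumr_const card_ffun card_bool card_ord -natrX.
apply: ler_sum => x _.
rewrite -[leRHS](@big1_eq _ _ *%R _ (index_enum 'I_N) predT).
apply: ler_prod => v _; rewrite /zero_weight; case: (x v); rewrite ?ler01 ?lexx//.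
by case: ifP => _; rewrite ?ler01 ?lexx// invr_ge0 invf_le1 ?ler1n ?ltr0n// ler0n.
Qed.
End MatchingAverage.

(** * Large deviations of the literals *)

Section Literals.
Variables (R : realType) (M k : nat).
Local Notation edge := ('I_M * 'I_k)%type.
Implicit Types (l : {ffun edge -> bool}) (e : edge).

Definition num_critical l : nat := #|[set e | edge_type l e == ord_max]|.

Lemma num_violated_edges l :
  #|[set e | edge_type l e == ord0]| = (num_all_equal l * k)%N.
Proof.
have -> : [set e | edge_type l e == ord0] =
    finset.setX [set a | all_equal l a] [set: 'I_k].
  apply/setP => -[a i]; rewrite !inE andbT /edge_type/=.
  case: ifP => // _; case: ifP => // _.
  by apply/eqP => /(congr1 val)/=; rewrite inordK.
by rewrite cardsX cardsT card_ord.
Qed.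

Implicit Types c : {ffun 'I_k -> bool}.

Definition flat c : bool := [forall i, forall j, c i == c j].
Definition odd_one c (i : 'I_k) : bool := [forall j, (j != i) ==> (c j != c i)].

(** A clause has [2] violating patterns, and [2 * k] patterns in which exactly
    one literal differs from all the others. *)
Lemma clause_mgf (theta phi : R) : (2 < k)%N -> 0 <= theta <= 1 -> 1 <= phi ->
  \sum_c theta ^+ flat c * phi ^+ #|[set i | ~~ flat c && odd_one c i]| <=
  2 ^+ k + 2 * (theta - 1) + 2 * k%:R * (phi - 1).
Proof.
move=> k2 /andP[t0 t1] p1.
have le1 c : (#|[set i | ~~ flat c && odd_one c i]| <= 1)%N.
  rewrite leqNgt; apply/negP => /card_gt1P[i [j []]].
  rewrite !inE => /andP[_ /forallP ci] /andP[_ /forallP cj] ij.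
  have [m /andP[mi mj]] : exists m : 'I_k, (m != i) && (m != j).
    have : (0 < #|~: [set i; j]|)%N.
      by rewrite cardsCs finset.setCK cards2 card_ord; case: (i != j); lia.
    by case/card_gt0P => m; rewrite !inE negb_or => h; exists m.
  have := implyP (ci m) mi; have := implyP (cj m) mj; have := implyP (ci j).
  by rewrite eq_sym ij => /(_ isT); case: (c i) (c j) (c m) => -[] [].
have split c : theta ^+ flat c * phi ^+ #|[set i | ~~ flat c && odd_one c i]| =
    1 + (theta - 1) * (flat c)%:R +
    (phi - 1) * (\sum_i (~~ flat c && odd_one c i)%N)%:R.
  have -> : (\sum_i (~~ flat c && odd_one c i) =
      #|[set i | ~~ flat c && odd_one c i]|)%N.
    rewrite -[RHS]sum1_card [RHS]big_mkcond/=; apply: eq_bigr => i _.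
    by rewrite inE; case: (_ && _).
  have := le1 c; case: (boolP (flat c)) => fc /=.
    rewrite (_ : [set i | false] = finset.set0) ?cards0; last by apply/setP => i; rewrite !inE.
    by move=> _; rewrite expr0 expr1 mulr0 addr0; ring.
  rewrite expr0 mul1r mulr0 addr0; case: #|_| => [|[|//]] _; rewrite ?expr0 ?expr1; ring.
under eq_bigr do rewrite split.
rewrite !big_split/= -!mulr_sumr -!natr_sum.
rewrite sumr_const card_ffun card_bool card_ord natrX; apply: lerD; [apply: lerD => //|].
- rewrite mulrC; apply: ler_wnM2r; first by rewrite subr_le0.
  have -> : (\sum_c flat c = #|[set c | flat c]|)%N.
    rewrite -[RHS]sum1_card [RHS]big_mkcond/=; apply: eq_bigr => c _.
    by rewrite inE; case: flat.
  have flat_cst (b : bool) : flat [ffun=> b].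
    by apply/forallP => i; apply/forallP => j; rewrite !ffunE.
  have k0 : (0 < k)%N by lia.
  rewrite ler_nat; apply/card_gt1P; exists [ffun=> true], [ffun=> false].
  rewrite !inE !flat_cst; split => //; apply/eqP => /ffunP/(_ (Ordinal k0)).
  by rewrite !ffunE.
- rewrite mulrC ler_wpM2r ?subr_ge0// -natrM ler_nat exchange_big/=.
  rewrite mulnC -[X in (X * 2)%N]card_ord -sum_nat_const; apply: leq_sum => i _.
  have -> : (\sum_c (~~ flat c && odd_one c i) =
      #|[set c | ~~ flat c && odd_one c i]|)%N.
    rewrite -[RHS]sum1_card [RHS]big_mkcond/=; apply: eq_bigr => c _.
    by rewrite inE; case: (_ && _).
  rewrite -card_bool -(@card_in_imset _ _ (fun c => c i)) ?max_card// => c c'.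
  rewrite !inE => /andP[_ /forallP h] /andP[_ /forallP h'] cc'.
  apply/ffunP => j; have [->//|ji] := eqVneq j i.
  have := implyP (h j) ji; have := implyP (h' j) ji; rewrite cc'.
  by case: (c j) (c' j) (c' i) => -[] [].
Qed.

Lemma literals_mgf (theta phi : R) : (2 < k)%N -> 0 <= theta <= 1 -> 1 <= phi ->
  \sum_l theta ^+ num_all_equal l * phi ^+ num_critical l <=
  (2 ^+ k + 2 * (theta - 1) + 2 * k%:R * (phi - 1)) ^+ M.
Proof.
move=> k2 t p; have /andP[t0 t1] := t; have p0 : 0 <= phi by exact: le_trans p.
rewrite sum_ffun_curry.
have split (F : {ffun 'I_M -> {ffun 'I_k -> bool}}) (l := [ffun b => F b.1 b.2]) :
    theta ^+ num_all_equal l * phi ^+ num_critical l =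
    \prod_a (theta ^+ flat (F a) *
             phi ^+ #|[set i | ~~ flat (F a) && odd_one (F a) i]|).
  have eqE a : all_equal l a = flat (F a).
    by apply: eq_forallb => i; apply: eq_forallb => j; rewrite !ffunE.
  have crE a i : critical l (a, i) = odd_one (F a) i.
    by apply: eq_forallb => j; rewrite !ffunE.
  have -> : num_all_equal l = (\sum_a flat (F a))%N.
    rewrite /num_all_equal -sum1_card big_mkcond/=; apply: eq_bigr => a _.
    by rewrite inE eqE; case: flat.
  have -> : num_critical l =
      (\sum_a #|[set i | ~~ flat (F a) && odd_one (F a) i]|)%N.
    rewrite /num_critical -sum1_card (partition_big (fun e => e.1) predT)//=.
    apply: eq_bigr => a _; rewrite -sum1_card.
    rewrite (reindex (fun i : 'I_k => (a, i)))/=; last first.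
      exists (fun e : edge => e.2) => // -[b i]; rewrite inE/= => /andP[_ /eqP ->//].
    apply: eq_bigl => i; rewrite !inE eqxx andbT /edge_type/= eqE crE.
    case: flat => //=; case: odd_one => //=; rewrite -?val_eqE/= ?inordK//.
  by rewrite -!prodrXr -big_split.
under eq_bigr do rewrite split.
rewrite -(bigA_distr_bigA (fun (_ : 'I_M) c =>
  theta ^+ flat c * phi ^+ #|[set i | ~~ flat c && odd_one c i]|))/=.
rewrite prodr_const card_ord; apply: lerXn2r; rewrite ?nnegrE ?clause_mgf//.
  by apply: sumr_ge0 => c _; rewrite mulr_ge0 ?exprn_ge0.
by apply: le_trans (clause_mgf k2 t p); apply: sumr_ge0 => c _;
  rewrite mulr_ge0 ?exprn_ge0.
Qed.

(** Exponential Markov inequality, with the probability [q] that a clause is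
    violated. *)
Lemma literals_Chernoff (s t E B : R) (q : R := 2 / 2 ^+ k) :
  (2 < k)%N -> 0 <= s -> 0 <= t ->
  #|[set l | ((num_all_equal l)%:R <= E) && (B <= (num_critical l)%:R)]|%:R <=
  2 ^+ (M * k) * (expR (s * E - t * B) *
    (1 + q * (expR (- s) - 1) + k%:R * q * (expR t - 1)) ^+ M).
Proof.
move=> k2 s0 t0.
have s1 : 0 <= expR (- s) <= 1.
  by rewrite expR_ge0/= -(@expR0 R) ler_expR oppr_le0.
have t1 : 1 <= expR t by rewrite -(@expR0 R) ler_expR.
have -> : 2 ^+ (M * k) * (expR (s * E - t * B) *
    (1 + q * (expR (- s) - 1) + k%:R * q * (expR t - 1)) ^+ M) =
    expR (s * E - t * B) *
    (2 ^+ k + 2 * (expR (- s) - 1) + 2 * k%:R * (expR t - 1)) ^+ M.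
  rewrite mulrCA; congr (_ * _); rewrite mulnC exprM -exprMn; congr (_ ^+ _).
  by rewrite /q; field; rewrite expf_neq0.
apply: le_trans (ler_wpM2l (expR_ge0 _) (literals_mgf k2 s1 t1)).
rewrite mulr_sumr -sum1_card natr_sum [leRHS](bigID (mem
  [set l | ((num_all_equal l)%:R <= E) && (B <= (num_critical l)%:R)]))/=.
rewrite ler_wpDr//.
  by apply: sumr_ge0 => l _; rewrite !mulr_ge0 ?exprn_ge0 ?expR_ge0.
apply: ler_sum => l; rewrite inE => /andP[lE lB].
rewrite -!expRM_natl -!expRD -{1}(@expR0 R) ler_expR.
have : 0 <= s * (E - (num_all_equal l)%:R) by rewrite mulr_ge0// subr_ge0.
have : 0 <= t * ((num_critical l)%:R - B) by rewrite mulr_ge0// subr_ge0.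
lra.
Qed.
End Literals.

(** * Low energies are unlikely *)

Section TiltedClauses.
Variables (R : realType) (M k : nat).
Local Notation edge := ('I_M * 'I_k)%type.
Implicit Types (l : {ffun edge -> bool}) (eta y z w : R).

Lemma ln_ge_div (z : R) : -1 < z -> z / (1 + z) <= ln (1 + z).
Proof.
move=> z1; have z0 : 0 < 1 + z by lra.
have := @le_ln1Dx R (- (z / (1 + z))).
have -> : 1 + - (z / (1 + z)) = (1 + z)^-1 by field; rewrite gt_eqF.
rewrite lnV ?posrE// lerN2; apply.
by rewrite ltrN2 ltr_pdivrMr//; lra.
Qed.

(** The exponents produced by an extra tilt of half the relative deviation. *)
Lemma tilt_down (y w : R) : y < 1 ->
  y / (1 - y) * (w * (1 - 2 * y)) - w * y = - (w * (y ^+ 2 / (1 - y))).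
Proof. by move=> y1; field; lra. Qed.

Lemma tilt_up (z w : R) : 0 <= z ->
  w * z - z / (1 + z) * (w * (1 + 2 * z)) = - (w * (z ^+ 2 / (1 + z))).
Proof. by move=> z0; field; lra. Qed.

(** The law of a clause reweighted by [eta] when it is violated: [tilt_viol] is
    the probability that it is violated, and [tilt_crit] the probability that a
    given edge is critical. Their quotient is [eta]. *)
Definition viol_prob : R := 2 / 2 ^+ k.
Definition tilt_mass eta : R := 1 - viol_prob + viol_prob * eta.
Definition tilt_viol eta : R := viol_prob * eta / tilt_mass eta.
Definition tilt_crit eta : R := viol_prob / tilt_mass eta.

(** Chernoff bound, with the optimal tilt, for the probability that at most a
    fraction [tilt_viol eta] of the clauses is violated. *)
Definition first_moment eta : R :=
  expR (- ln eta * (M%:R * tilt_viol eta)) * tilt_mass eta ^+ M.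

Lemma viol_prob_gt0 : 0 < viol_prob.
Proof. by rewrite divr_gt0// exprn_gt0. Qed.

Lemma viol_prob_le : (2 < k)%N -> viol_prob <= 4^-1.
Proof.
move=> k2; rewrite /viol_prob ler_pdivrMr ?exprn_gt0//.
have : 2 ^+ 3 <= 2 ^+ k :> R by rewrite ler_weXn2l// ler1n.
lra.
Qed.

Lemma tilt_mass_gt0 eta : (2 < k)%N -> 0 < eta -> 0 < tilt_mass eta.
Proof.
move=> /viol_prob_le q4 e0; have : 0 < viol_prob * eta by rewrite mulr_gt0 ?viol_prob_gt0.
rewrite /tilt_mass; lra.
Qed.

Lemma tilt_viol_gt0 eta : (2 < k)%N -> 0 < eta -> 0 < tilt_viol eta.
Proof. by move=> k2 e0; rewrite divr_gt0 ?mulr_gt0 ?viol_prob_gt0 ?tilt_mass_gt0. Qed.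

Lemma tilt_viol_le1 eta : (2 < k)%N -> 0 < eta -> tilt_viol eta <= 1.
Proof.
move=> k2 e0; rewrite ler_pdivrMr ?tilt_mass_gt0// mul1r /tilt_mass lerDr.
by have := viol_prob_le k2; lra.
Qed.

Lemma tilt_crit_gt0 eta : (2 < k)%N -> 0 < eta -> 0 < tilt_crit eta.
Proof. by move=> k2 e0; rewrite divr_gt0 ?viol_prob_gt0 ?tilt_mass_gt0. Qed.

Lemma tilted_mgf eta y z : (2 < k)%N -> 0 < eta ->
  1 + viol_prob * (eta * y - 1) + k%:R * viol_prob * z =
  tilt_mass eta * (1 + tilt_viol eta * (y - 1) + k%:R * (tilt_crit eta * z)).
Proof.
move=> k2 e0; have := tilt_mass_gt0 k2 e0.
move=> m0; transitivity (tilt_mass eta + viol_prob * eta * (y - 1) +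
    k%:R * viol_prob * z); first by rewrite /tilt_mass; ring.
by rewrite /tilt_viol /tilt_crit; field; rewrite gt_eqF.
Qed.

Lemma few_violated_literals eta : (2 < k)%N -> 0 < eta <= 1 ->
  #|[set l : {ffun edge -> bool} | (num_all_equal l)%:R <= M%:R * tilt_viol eta]|%:R <=
  2 ^+ (M * k) * first_moment eta.
Proof.
move=> k2 /andP[e0 e1]; have s0 : 0 <= - ln eta by rewrite oppr_ge0 ln_le0.
have := @literals_Chernoff R M k (- ln eta) 0 (M%:R * tilt_viol eta) 0 k2 s0 (lexx _).
rewrite expR0 subrr !mulr0 subr0 addr0 opprK lnK ?posrE//.
rewrite -/viol_prob (_ : 1 + viol_prob * (eta - 1) = tilt_mass eta); last first.
  by rewrite /tilt_mass; ring.
apply: le_trans; rewrite ler_nat; apply: eq_leq; apply: eq_card => l.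
by rewrite !inE ler0n andbT.
Qed.

(** A violated clause is reweighted by [eta * (1 - r / 2)]. *)
Lemma very_few_violated_literals eta r : (2 < k)%N -> 0 < eta <= 1 -> 0 <= r <= 1 ->
  #|[set l : {ffun edge -> bool} | (num_all_equal l)%:R <= M%:R * tilt_viol eta * (1 - r)]|%:R <=
  2 ^+ (M * k) *
    (first_moment eta * expR (- (M%:R * tilt_viol eta * r ^+ 2 / 4))).
Proof.
move=> k2 /andP[e0 e1] /andP[r0 r1].
have s0 : 0 <= - ln eta by rewrite oppr_ge0 ln_le0.
have a0 := tilt_viol_gt0 k2 e0; have a1 := tilt_viol_le1 k2 e0.
have m0 := tilt_mass_gt0 k2 e0.
pose E := M%:R * tilt_viol eta; rewrite -/E.
have E0 : 0 <= E by rewrite mulr_ge0// ltW.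
have [y rE] : exists y, r = 2 * y by exists (r / 2); rewrite mulrC divfK.
have {r0} y0 : 0 <= y by lra.
have y1 : y < 1 by lra.
have sy : 0 <= - ln (1 - y) by rewrite oppr_ge0 ln_le0//; lra.
have syle : - ln (1 - y) <= y / (1 - y).
  have := @ln_ge_div (- y); rewrite ltrN2 => /(_ y1); rewrite mulNr; lra.
have := @literals_Chernoff R M k (- ln eta - ln (1 - y)) 0 (E * (1 - r)) 0 k2
  (addr_ge0 s0 sy) (lexx _).
rewrite expR0 subrr !mulr0 subr0 addr0 opprD !opprK expRD !lnK ?posrE ?subr_gt0//.
rewrite -/viol_prob; have := tilted_mgf (1 - y) 0 k2 e0.
rewrite !mulr0 !addr0 => -> Ch; apply: le_trans (le_trans Ch _).
  rewrite ler_nat; apply: subset_leq_card; apply/fintype.subsetP => l.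
  by rewrite !inE ler0n andbT.
rewrite ler_wpM2l ?exprn_ge0// exprMn mulrCA.
rewrite [leRHS](_ : _ = tilt_mass eta ^+ M *
    (expR (- ln eta * E) * expR (- (E * r ^+ 2 / 4)))); last first.
  by rewrite /first_moment -/E; ring.
rewrite ler_wpM2l ?exprn_ge0 ?(ltW m0)//.
have -> : 1 + tilt_viol eta * (1 - y - 1) = 1 + - (tilt_viol eta * y) by ring.
have pw : (1 + - (tilt_viol eta * y)) ^+ M <= expR (- (E * y)).
  have -> : - (E * y) = M%:R * - (tilt_viol eta * y) by rewrite /E; ring.
  rewrite expRM_natl; apply: lerXn2r; rewrite ?nnegrE ?expR_ge0 ?expR_ge1Dx//.
  by rewrite subr_ge0 mulr_ile1 ?(ltW a0) ?(ltW y1).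
apply: le_trans (ler_wpM2l (expR_ge0 _) pw) _.
rewrite -!expRD ler_expR.
have h1 : 0 <= - ln eta * (E * r) by rewrite mulr_ge0// mulr_ge0//; lra.
have h2 : - ln (1 - y) * (E * (1 - r)) <= y / (1 - y) * (E * (1 - r)).
  by rewrite ler_wpM2r// mulr_ge0// subr_ge0.
have h3 : y / (1 - y) * (E * (1 - r)) - E * y <= - (E * r ^+ 2 / 4).
  rewrite {1}rE tilt_down// lerN2 -mulrA ler_wpM2l//.
  rewrite (_ : r ^+ 2 / 4 = y ^+ 2); last by rewrite rE; field.
  by rewrite ler_pdivlMr ?subr_gt0// ler_piMr ?sqr_ge0//; lra.
lra.
Qed.

(** A critical edge is reweighted by [1 + r / 2], on top of [eta] for a violated
    clause. *)
Lemma many_critical_literals eta r : (2 < k)%N -> 0 < eta <= 1 -> 0 <= r <= 1 ->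
  #|[set l : {ffun edge -> bool} | ((num_all_equal l)%:R <= M%:R * tilt_viol eta) &&
      ((M * k)%:R * tilt_crit eta * (1 + r) <= (num_critical l)%:R)]|%:R <=
  2 ^+ (M * k) *
    (first_moment eta * expR (- ((M * k)%:R * tilt_crit eta * r ^+ 2 / 6))).
Proof.
move=> k2 /andP[e0 e1] /andP[r0 r1].
have s0 : 0 <= - ln eta by rewrite oppr_ge0 ln_le0.
have b0 := tilt_crit_gt0 k2 e0; have m0 := tilt_mass_gt0 k2 e0.
pose E := M%:R * tilt_viol eta; rewrite -/E.
pose W := (M * k)%:R * tilt_crit eta; rewrite -/W.
have W0 : 0 <= W by rewrite mulr_ge0// ltW.
have [z rE] : exists z, r = 2 * z by exists (r / 2); rewrite mulrC divfK.
have {r0} z0 : 0 <= z by lra.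
have tz : 0 <= ln (1 + z) by rewrite ln_ge0//; lra.
have tzge : z / (1 + z) <= ln (1 + z) by apply: ln_ge_div; lra.
have := @literals_Chernoff R M k (- ln eta) (ln (1 + z)) E (W * (1 + r)) k2 s0 tz.
rewrite opprK !lnK ?posrE//; last by lra.
rewrite -/viol_prob; have := tilted_mgf 1 (1 + z - 1) k2 e0; rewrite mulr1 => -> Ch.
apply: (le_trans Ch).
rewrite ler_wpM2l ?exprn_ge0// subrr mulr0 addr0 exprMn mulrCA.
rewrite [leRHS](_ : _ = tilt_mass eta ^+ M *
  (expR (- ln eta * E) * expR (- (W * r ^+ 2 / 6)))); last first.
  by rewrite /first_moment -/E; ring.
rewrite ler_wpM2l ?exprn_ge0 ?(ltW m0)// (_ : 1 + z - 1 = z); last by ring.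
have pw : (1 + k%:R * (tilt_crit eta * z)) ^+ M <= expR (W * z).
  have -> : W * z = M%:R * (k%:R * (tilt_crit eta * z)) by rewrite /W natrM; ring.
  rewrite expRM_natl; apply: lerXn2r; rewrite ?nnegrE ?expR_ge0 ?expR_ge1Dx//.
  by rewrite addr_ge0// mulr_ge0// mulr_ge0// (ltW b0).
apply: le_trans (ler_wpM2l (expR_ge0 _) pw) _.
rewrite -!expRD ler_expR.
have h2 : z / (1 + z) * (W * (1 + r)) <= ln (1 + z) * (W * (1 + r)).
  by rewrite ler_wpM2r// mulr_ge0//; lra.
have h3 : W * z - z / (1 + z) * (W * (1 + r)) <= - (W * (r ^+ 2 / 6)).
  rewrite {1}rE tilt_up// lerN2 ler_wpM2l//.
  have : z ^+ 2 / (3 / 2) <= z ^+ 2 / (1 + z).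
    by rewrite ler_wpM2l ?sqr_ge0// lef_pV2 ?posrE; lra.
  by rewrite rE exprMn; lra.
lra.
Qed.
End TiltedClauses.

Section LowEnergy.
Variables (R : realType) (N M d k : nat).
Local Notation edge := ('I_M * 'I_k)%type.
Local Notation slot := ('I_N * 'I_d)%type.
Implicit Types (l : {ffun edge -> bool}) (E : R).

Definition low_energy E : {set configuration N M d k} :=
  [set G in instances N M d k | (min_violated G)%:R <= E].

Definition energy_fraction E : R := #|low_energy E|%:R / #|instances N M d k|%:R.

Lemma card_instances : (M * k = N * d)%N ->
  #|instances N M d k|%:R = (#|{: edge}|)`!%:R * 2 ^+ (M * k) :> R.
Proof.
move=> MkNd; have AB : #|{: edge}| = #|{: slot}| by rewrite !card_prod !card_ord.
have := @card_instances_pred N M d k predT.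
rewrite (_ : [set G in _ | predT G.1] = instances N M d k); last first.
  by apply/setP => G; rewrite inE andbT.
rewrite (_ : [set g in _ | predT g] = matchings edge slot); last first.
  by apply/setP => g; rewrite inE andbT.
by move=> ->; rewrite matchings_card// natrM natrX.
Qed.

(** The instances with many doubled variables are set aside; for the others
    the first moment factorizes over literals and matchings. *)
Lemma energy_fraction_le E (D : nat) : (1 < k)%N -> (M * k = N * d)%N ->
  energy_fraction E <= (d * k)%:R / D.+1%:R +
    2 ^+ D * \sum_(l : {ffun edge -> bool} | (num_all_equal l)%:R <= E)
     (\sum_(g in matchings edge slot) \sum_(x : {ffun 'I_N -> bool})
      \prod_v (if x v then 1 else zero_weight d R (local_sum g l v))) /
     #|instances N M d k|%:R.
Proof.
move=> k1 MkNd; set I := instances N M d k.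
have I0 : 0 < #|I|%:R :> R by rewrite ltr0n instances_gt0.
rewrite /energy_fraction -mulr_suml mulrA -ler_pdivlMr ?invr_gt0// invrK mulrDl.
rewrite divfK ?gt_eqF//.
pose A := [set G in I | (D < #|[set v | doubled G.1 v]|)%N].
apply: (@le_trans _ _ (#|A|%:R + #|[set G in I |
    ((min_violated G)%:R <= E) && (#|[set v | doubled G.1 v]| <= D)%N]|%:R)).
  rewrite -natrD ler_nat; apply: leq_trans (leq_card_setU _ _).
  apply/subset_leq_card/fintype.subsetP => G.
  rewrite /low_energy -/I finset.in_setU !finset.in_set => /andP[-> ->]/=.
  by rewrite ltnNge orNb.
apply: lerD; last exact: few_violations.
rewrite mulrAC ler_pdivlMr// -!natrM ler_nat mulnC.
exact: doubled_rare.
Qed.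

(** The plain first moment, where the extremality of the minimizer is given away. *)
Lemma energy_fraction_plain (eta : R) (D : nat) :
  (2 < k)%N -> (M * k = N * d)%N -> 0 < eta <= 1 ->
  energy_fraction (M%:R * tilt_viol k eta) <= (d * k)%:R / D.+1%:R +
    2 ^+ D * (2 ^+ N * first_moment M k eta).
Proof.
move=> k2 MkNd e01.
apply: le_trans (energy_fraction_le _ D (ltnW k2) MkNd) _.
rewrite lerD2l ler_wpM2l ?exprn_ge0//.
have I0 : 0 < #|instances N M d k|%:R :> R by rewrite ltr0n instances_gt0.
set E := _ * tilt_viol _ _.
apply: (@le_trans _ _ (\sum_(l : {ffun edge -> bool} | (num_all_equal l)%:R <= E)
    (2 ^+ N / 2 ^+ (M * k)))).
  apply: ler_sum => l _; rewrite ler_pdivrMr//.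
  apply: le_trans (matching_average_trivial R l MkNd) _.
  rewrite card_instances// le_eqVlt; apply/orP; left; apply/eqP.
  by field; rewrite expf_neq0.
rewrite sumr_const -[X in X <= _]mulr_natr -mulrA ler_wpM2l ?exprn_ge0//.
rewrite mulrC ler_pdivrMr ?exprn_gt0// [leRHS]mulrC.
apply: le_trans (few_violated_literals M k2 e01); rewrite ler_nat.
by apply: eq_leq; apply: eq_card => l; rewrite !inE.
Qed.

(** Fluctuations of the number of violated clauses below [1 - ra] times its
    mean under the tilted law, and of the number of critical edges above [1 + rb]
    times its mean, are paid for separately; otherwise the extremality of the
    minimizer costs a factor [1 - g / 4] per variable. *)
Lemma energy_fraction_window (eta ra rb : R) (D : nat)
    (a := tilt_viol k eta) (b := tilt_crit k eta)
    (g := iter d (walk (a * (1 - ra)) (b * (1 + rb))) (delta_at R 0) 0) :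
  (2 < k)%N -> (M * k = N * d)%N -> (0 < N)%N -> (0 < d)%N -> 0 < eta <= 1 ->
  0 <= ra <= 1 -> 0 <= rb <= 1 -> a * (1 - ra) + b * (1 + rb) <= 1 ->
  energy_fraction (M%:R * a) <= (d * k)%:R / D.+1%:R +
    2 ^+ D * ((expR 1 * (M * k).+1%:R) ^+ 3 * (2 ^+ N * first_moment M k eta *
    (expR (- (N%:R * g / 4)) +
     (ra < 1)%R%:R * expR (- (M%:R * a * ra ^+ 2 / 4)) +
     expR (- ((M * k)%:R * b * rb ^+ 2 / 6))))).
Proof.
have aE : a = tilt_viol k eta by []; have bE : b = tilt_crit k eta by [].
have gE : g = iter d (walk (a * (1 - ra)) (b * (1 + rb))) (delta_at R 0) 0 by [].
move: a b aE bE g gE => a b aE bE g gE.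
move=> k2 MkNd N0 d0 e01 ra01 rb01 ab1; have /andP[e0 e1] := e01.
have /andP[ra0 ra1] := ra01; have /andP[rb0 rb1] := rb01.
have a0 : 0 < a by rewrite aE tilt_viol_gt0.
have b0 : 0 < b by rewrite bE tilt_crit_gt0.
have I0 : 0 < #|instances N M d k|%:R :> R by rewrite ltr0n instances_gt0.
have cE : #|{: edge}| = (M * k)%N by rewrite card_prod !card_ord.
apply: le_trans (energy_fraction_le _ D (ltnW k2) MkNd) _.
rewrite lerD2l ler_wpM2l ?exprn_ge0//.
have [E EE] : exists E, E = M%:R * a by exists (M%:R * a).
rewrite -!EE.
have [K KE] : exists K, K = (expR 1 * (M * k).+1%:R) ^+ 3 :> R by eexists.
have K1 : 1 <= K by rewrite KE exprn_ege1// mulr_ege1 ?ler1n// -(@expR0 R) ler_expR.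
rewrite -!KE.
have E0 : 0 <= E by rewrite EE mulr_ge0// ltW.
pose lowV l := (num_all_equal l)%:R < E * (1 - ra).
pose manyC l := (M * k)%:R * b * (1 + rb) < (num_critical l)%:R.
pose X l : R := (\sum_(g in matchings edge slot) \sum_(x : {ffun 'I_N -> bool})
  \prod_v (if x v then 1 else zero_weight d R (local_sum g l v))) /
    #|instances N M d k|%:R.
have norm (Y : R) : (#|{: edge}|)`!%:R * Y / #|instances N M d k|%:R =
    Y / 2 ^+ (M * k).
  by rewrite card_instances//; field; rewrite expf_neq0//= pnatr_eq0 -lt0n fact_gt0.
have Xtriv l : X l <= K * 2 ^+ N / 2 ^+ (M * k).
  rewrite -norm /X ler_wpM2r ?invr_ge0 ?(ltW I0)//.
  apply: le_trans (matching_average_trivial R l MkNd) _.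
  by rewrite ler_wpM2l// ler_peMl// exprn_ge0.
have Xwin l : ~~ lowV l -> ~~ manyC l ->
    X l <= K * (2 ^+ N * expR (- (N%:R * g / 4))) / 2 ^+ (M * k).
  rewrite -!leNgt => lV mC; rewrite -norm /X ler_wpM2r ?invr_ge0 ?(ltW I0)//.
  have Mk0 : (0 < M * k)%N by rewrite MkNd muln_gt0 N0.
  have /andP[M0 k0] : (0 < M)%N && (0 < k)%N by rewrite -muln_gt0.
  have c0 : (0 < #|{: edge}|)%N by rewrite cE.
  have h1 : a * (1 - ra) <= type_freq R l ord0.
    rewrite /type_freq num_violated_edges cE !natrM ler_pdivlMr ?mulr_gt0 ?ltr0n//.
    by rewrite mulrA ler_pM2r ?ltr0n// mulrC mulrA -EE.
  have h2 : type_freq R l ord_max <= b * (1 + rb).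
    by rewrite /type_freq cE ler_pdivrMr ?ltr0n// mulrC mulrA.
  have h0 : 0 <= a * (1 - ra) by rewrite mulr_ge0 ?(ltW a0)// subr_ge0.
  apply: le_trans (matching_average MkNd c0 h0 h1 h2 ab1) _.
  rewrite -mulrA ler_wpM2l// cE -gE -KE ler_wpM2l//; first by apply: le_trans K1.
  have g1 : g <= 1.
    rewrite gE -[leRHS](@iter_walk_const R (a * (1 - ra)) (b * (1 + rb)) d 1 0).
    apply: iter_walk_le => // [|s]; first by rewrite mulr_ge0 ?(ltW b0)// addr_ge0.
    by rewrite /delta_at; case: eqP.
  have -> : - (N%:R * g / 4) = N%:R * (- (g / 4)) by ring.
  rewrite expRM_natl -exprMn; apply: lerXn2r; rewrite ?nnegrE.
  - by lra.
  - by rewrite mulr_ge0 ?expR_ge0.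
  - by have := expR_ge1Dx (- (g / 4)); lra.
have Xle l : (num_all_equal l)%:R <= E ->
  X l <= K / 2 ^+ (M * k) * (2 ^+ N * expR (- (N%:R * g / 4)) +
     2 ^+ N * (lowV l)%:R + 2 ^+ N * (manyC l)%:R).
  move=> lE; have pos : 0 <= K / 2 ^+ (M * k).
    by rewrite divr_ge0 ?exprn_ge0// (le_trans _ K1).
  have p1 : 0 <= 2 ^+ N * expR (- (N%:R * g / 4)) by rewrite mulr_ge0 ?exprn_ge0 ?expR_ge0.
  have p2 : 0 <= 2 ^+ N :> R by rewrite exprn_ge0.
  have [lV|lV] := boolP (lowV l).
    apply: (le_trans (Xtriv l)); rewrite mulrAC ler_wpM2l// mulr1.
    by rewrite addrAC ler_wpDl// addr_ge0// mulr_ge0.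
  have [mC|mC] := boolP (manyC l).
    by apply: (le_trans (Xtriv l)); rewrite mulrAC ler_wpM2l// mulr1 mulr0 addr0 ler_wpDl.
  by apply: (le_trans (Xwin l lV mC)); rewrite mulrAC ler_wpM2l// !mulr0 !addr0.
apply: (le_trans (ler_sum _ Xle)).
rewrite -mulr_sumr !big_split/= -!mulr_sumr.
pose C p := #|[set l : {ffun edge -> bool} | p l]|%:R : R.
have sumC (p : pred {ffun edge -> bool}) :
    \sum_(l : {ffun edge -> bool} | (num_all_equal l)%:R <= E) (p l)%:R =
    C (fun l => ((num_all_equal l)%:R <= E) && p l).
  rewrite /C -sum1_card natr_sum big_mkcond [RHS]big_mkcond/=.
  by apply: eq_bigr => l _; rewrite inE; case: (_ <= E) => //=; case: (p l).
have C1 : \sum_(l : {ffun edge -> bool} | (num_all_equal l)%:R <= E)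
    expR (- (N%:R * g / 4)) <=
    2 ^+ (M * k) * (first_moment M k eta * expR (- (N%:R * g / 4))).
  rewrite sumr_const -[leLHS]mulr_natl mulrA ler_wpM2r ?expR_ge0//.
  apply: le_trans (few_violated_literals M k2 e01); rewrite ler_nat.
  by apply: eq_leq; apply: eq_card => l; rewrite !inE EE aE.
have C2 : \sum_(l : {ffun edge -> bool} | (num_all_equal l)%:R <= E) (lowV l)%:R <=
   2 ^+ (M * k) * (first_moment M k eta *
     ((ra < 1)%R%:R * expR (- (E * ra ^+ 2 / 4)))).
  rewrite sumC; have [ra_lt|ra_ge] := ltP ra 1; last first.
    rewrite /C (_ : [set l | _] = finset.set0) ?cards0 ?mul0r ?mulr0//.
    apply/setP => l; rewrite !inE /lowV (_ : ra = 1); last by apply/le_anti; rewrite ra1.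
    by rewrite subrr mulr0 ltrn0 andbF.
  rewrite mul1r EE aE; apply: le_trans (very_few_violated_literals M k2 e01 ra01).
  rewrite ler_nat; apply: subset_leq_card; apply/fintype.subsetP => l.
  by rewrite !inE /lowV EE aE => /andP[_ /ltW].
have C3 : \sum_(l : {ffun edge -> bool} | (num_all_equal l)%:R <= E) (manyC l)%:R <=
   2 ^+ (M * k) * (first_moment M k eta * expR (- ((M * k)%:R * b * rb ^+ 2 / 6))).
  rewrite sumC bE; apply: le_trans (many_critical_literals M k2 e01 rb01).
  rewrite ler_nat; apply: subset_leq_card; apply/fintype.subsetP => l.
  by rewrite !inE /manyC EE aE bE => /andP[-> /ltW].
rewrite -(mulrA K) ler_wpM2l//; first by rewrite (le_trans _ K1).
rewrite [leLHS]mulrC ler_pdivrMr ?exprn_gt0//.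
have N20 : 0 <= 2 ^+ N :> R by rewrite exprn_ge0.
have D1 := ler_wpM2l N20 C1; have D2 := ler_wpM2l N20 C2; have D3 := ler_wpM2l N20 C3.
apply: le_trans (lerD (lerD D1 D2) D3) _.
by rewrite le_eqVlt; apply/orP; left; apply/eqP; ring.
Qed.
End LowEnergy.

(** * The functions of the energy parameter *)

(** The tangent bound for the logarithm of the square root. *)
Lemma mul_ln_ge (R : realType) (v : R) : 0 < v ->
  2 * v - 2 * Num.sqrt v <= v * ln v.
Proof.
move=> v0; have s0 : 0 < Num.sqrt v by rewrite sqrtr_gt0.
have vE : v = Num.sqrt v ^+ 2 by rewrite sqr_sqrtr// ltW.
move: (Num.sqrt v) s0 vE => s s0 ->; rewrite lnXn//.
have := @ln_ge_div R (s - 1); rewrite [1 + _]addrC subrK => h.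
have {}h : s ^+ 2 * ((s - 1) / s) <= s ^+ 2 * ln s.
  by rewrite ler_wpM2l ?sqr_ge0//; apply: h; lra.
have e : s ^+ 2 * ((s - 1) / s) = s ^+ 2 - s by field; rewrite gt_eqF.
rewrite e in h; rewrite -mulr_natl; lra.
Qed.

Section EnergyFunctions.
Variables (R : realType) (k : nat) (p : R).
Local Notation u := (1 - p).
Local Notation Q := (2 ^+ k.-1 : R).
Local Notation q := (viol_prob R k).
Local Notation eta := (eta_p k p).
Local Notation s := (Num.sqrt eta).
Local Notation c := (c_p k p).

Lemma ln2_bounds : 2^-1 <= ln (2 : R) <= 1.
Proof.
have := @ln_ge_div R 1; have := @le_ln1Dx R 1.
have -> : 1 + 1 = 2 :> R by [].
by move=> h1 h2; apply/andP; split; [have := h2|have := h1]; rewrite ?div1r; apply; lra.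
Qed.

Lemma pow_gt_k (k6 : (6 <= k)%N) : k.+1%:R <= Q.
Proof.
have : (k.+1 <= 2 ^ k.-1)%N.
  have := ltn_expl k.-2 (isT : (1 < 2)%N).
  have -> : (2 ^ k.-1 = 2 * 2 ^ k.-2)%N by rewrite -expnS; congr (_ ^ _)%N; lia.
  lia.
by rewrite -natrX ler_nat.
Qed.

Lemma pow_32 (k6 : (6 <= k)%N) : 32 <= Q.
Proof.
have -> : 32 = 2 ^+ 5 :> R by rewrite -natrX.
by rewrite ler_weXn2l ?ler1n//; lia.
Qed.

Lemma viol_probE (k6 : (6 <= k)%N) : q = Q^-1.
Proof.
rewrite /viol_prob (_ : 2 ^+ k = 2 * Q).
  by rewrite invfM mulrA divff ?mul1r// pnatr_eq0.
by rewrite -exprS; congr (_ ^+ _); lia.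
Qed.

Lemma eta_gt0 (k6 : (6 <= k)%N) (p0 : 0 < p) (p1 : p < 1) : 0 < eta.
Proof.
have := (pow_32 k6) => Q32.
by rewrite /eta_p divr_gt0 ?mulr_gt0//; lra.
Qed.

Lemma eta_le (k6 : (6 <= k)%N) (p0 : 0 < p) (p1 : p < 1) : eta <= u.
Proof.
have := (pow_32 k6) => Q32; rewrite /eta_p ler_pdivrMr; last by lra.
by rewrite ler_pM2l//; lra.
Qed.

Lemma eta_lt1 (k6 : (6 <= k)%N) (p0 : 0 < p) (p1 : p < 1) : eta < 1. Proof. by apply: le_lt_trans (eta_le k6 p0 p1) _; lra. Qed.

Lemma sqrt_eta_bounds (k6 : (6 <= k)%N) (p0 : 0 < p) (p1 : p < 1) : 0 < s < 1.
Proof.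
rewrite sqrtr_gt0 (eta_gt0 k6 p0 p1)/= -[ltRHS]sqrtr1 ltr_sqrt// (eta_lt1 k6 p0 p1)//.
Qed.

Lemma tilt_massE (k6 : (6 <= k)%N) (p0 : 0 < p) (p1 : p < 1) : tilt_mass k eta = (Q - 1) / (Q - u).
Proof.
have Q32 := (pow_32 k6); rewrite /tilt_mass (viol_probE k6) /eta_p.
by field; apply/andP; split; rewrite gt_eqF//; lra.
Qed.

Lemma tilt_violE (k6 : (6 <= k)%N) (p0 : 0 < p) (p1 : p < 1) : tilt_viol k eta = q * u.
Proof.
have Q32 := (pow_32 k6); rewrite /tilt_viol (tilt_massE k6 p0 p1) (viol_probE k6) /eta_p.
by field; rewrite !gt_eqF//; lra.
Qed.

Lemma tilt_critE (k6 : (6 <= k)%N) (p0 : 0 < p) (p1 : p < 1) : tilt_crit k eta = q * ((Q - u) / (Q - 1)).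
Proof. by rewrite /tilt_crit (tilt_massE k6 p0 p1) invf_div. Qed.

(** The exponent of the first moment is the relative entropy of a clause, a
    multiple of [c_p^-1]. *)
Lemma first_momentE (k6 : (6 <= k)%N) (p0 : 0 < p) (p1 : p < 1) (M : nat) :
  first_moment M k eta = expR (- (M%:R * (q * c^-1))).
Proof.
have u0 : 0 < u by lra.
have Q32 := (pow_32 k6).
have m0 : 0 < (Q - u) / (Q - 1) by rewrite divr_gt0//; lra.
have mE : tilt_mass k eta = expR (- ln ((Q - u) / (Q - 1))).
  by rewrite expRN lnK ?posrE// (tilt_massE k6 p0 p1) invf_div.
have eE : ln eta = ln u - ln ((Q - u) / (Q - 1)).
  have -> : eta = u / ((Q - u) / (Q - 1)) by rewrite /eta_p invf_div mulrA.
  move: m0; set z := _ / _ => z0.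
  have -> : ln (u / z) = ln u + ln z^-1 by apply: lnM; rewrite posrE// invr_gt0.
  by rewrite lnV.
rewrite /first_moment (tilt_violE k6 p0 p1) mE -expRM_natl -expRD eE /c_p invrK; congr expR.
by rewrite (viol_probE k6); field; rewrite gt_eqF//; lra.
Qed.

(** The relative entropy is comparable with the squared Hellinger distance,
    whose main term is [(1 - sqrt eta) ^+ 2]. *)
Lemma c_inv_ge (k6 : (6 <= k)%N) (p0 : 0 < p) (p1 : p < 1) : (1 - Num.sqrt u) ^+ 2 <= c^-1.
Proof.
have u0 : 0 < u by lra.
have Q32 := (pow_32 k6); rewrite /c_p invrK.
have ln1 : 1 - u <= (Q - u) * ln ((Q - u) / (Q - 1)).
  have zE : (Q - u) / (Q - 1) = 1 + (1 - u) / (Q - 1) by field; rewrite gt_eqF//; lra.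
  have := @ln_ge_div R ((1 - u) / (Q - 1)); rewrite -zE.
  have -> : (1 - u) / (Q - 1) / ((Q - u) / (Q - 1)) = (1 - u) / (Q - u).
    by field; rewrite !gt_eqF//; lra.
  move=> h; rewrite mulrC -ler_pdivrMr; last by lra.
  by apply: h; apply: (@lt_trans _ _ 0); [lra|rewrite divr_gt0//; lra].
have uE : u = Num.sqrt u ^+ 2 by rewrite sqr_sqrtr// ltW.
have ln2 := mul_ln_ge u0.
have -> : (1 - Num.sqrt u) ^+ 2 = 1 - 2 * Num.sqrt u + u.
  by rewrite {3}uE; ring.
lra.
Qed.

Lemma c_inv_le (k6 : (6 <= k)%N) (p0 : 0 < p) (p1 : p < 1) : c^-1 <= 2 * (1 - u) ^+ 2.
Proof.
have u0 : 0 < u by lra.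
have Q32 := (pow_32 k6); rewrite /c_p invrK.
have ln1 : (Q - u) * ln ((Q - u) / (Q - 1)) <= (1 - u) * (1 + (1 - u) / (Q - 1)).
  have zE : (Q - u) / (Q - 1) = 1 + (1 - u) / (Q - 1) by field; rewrite gt_eqF//; lra.
  have := @le_ln1Dx R ((1 - u) / (Q - 1)); rewrite -zE => h.
  have -> : (1 - u) * ((Q - u) / (Q - 1)) = (Q - u) * ((1 - u) / (Q - 1)) by ring.
  rewrite ler_pM2l; last by lra.
  by apply: h; apply: (@lt_trans _ _ 0); [lra|rewrite divr_gt0//; lra].
have ln2 : u * ln u <= u * (u - 1).
  rewrite ler_pM2l//; have := @le_ln1Dx R (u - 1).
  rewrite (_ : 1 + (u - 1) = u); last by ring.
  by apply; lra.
have : (1 - u) * ((1 - u) / (Q - 1)) <= (1 - u) * (1 - u).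
  rewrite ler_pM2l; last by lra.
  by rewrite ler_pdivrMr; [nra|lra].
rewrite expr2; lra.
Qed.

Lemma c_gt0 (k6 : (6 <= k)%N) (p0 : 0 < p) (p1 : p < 1) : 0 < c.
Proof.
have u0 : 0 < u by lra.
have u1 : u < 1 by lra.
rewrite -invr_gt0; apply: lt_le_trans (c_inv_ge k6 p0 p1).
rewrite exprn_gt0// subr_gt0 -[ltRHS]sqrtr1 ltr_sqrt//.
Qed.

Lemma c_ge (k6 : (6 <= k)%N) (p0 : 0 < p) (p1 : p < 1) : 2^-1 <= c.
Proof.
have c0 := (c_gt0 k6 p0 p1); rewrite -[c]invrK lef_pV2 ?posrE//; last by rewrite invr_gt0.
apply: (le_trans (c_inv_le k6 p0 p1)); rewrite -[leRHS]mulr1 ler_pM2l// exprn_ile1//; lra.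
Qed.

Lemma c_sqr_le (k6 : (6 <= k)%N) (p0 : 0 < p) (p1 : p < 1) : c * (1 - s) ^+ 2 <= 16.
Proof.
have u0 : 0 < u by lra.
have u1 : u < 1 by lra.
have c0 := (c_gt0 k6 p0 p1); have /andP[s0 s1] := (sqrt_eta_bounds k6 p0 p1); have Q32 := (pow_32 k6).
have v0 : 0 < Num.sqrt u by rewrite sqrtr_gt0.
have v1 : Num.sqrt u < 1 by rewrite -[ltRHS]sqrtr1 ltr_sqrt.
have uE : u = Num.sqrt u ^+ 2 by rewrite sqr_sqrtr// ltW.
have sE : eta = s ^+ 2 by rewrite sqr_sqrtr// ltW// (eta_gt0 k6 p0 p1).
have e1 : 1 - eta <= 2 * (1 - u).
  have -> : 1 - eta = (1 - u) * (Q / (Q - u)).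
    by rewrite /eta_p; field; rewrite gt_eqF//; lra.
  rewrite [leRHS]mulrC ler_pM2l; last by lra.
  by rewrite ler_pdivrMr; lra.
have h1 : 1 - s <= 4 * (1 - Num.sqrt u) by nra.
have h2 : (1 - s) ^+ 2 <= 16 * c^-1.
  apply: (@le_trans _ _ (16 * (1 - Num.sqrt u) ^+ 2)); last first.
    by rewrite ler_pM2l// (c_inv_ge k6 p0 p1).
  have -> : 16 * (1 - Num.sqrt u) ^+ 2 = (4 * (1 - Num.sqrt u)) ^+ 2 by ring.
  by apply: lerXn2r; rewrite ?nnegrE; lra.
by rewrite mulrC -ler_pdivlMr.
Qed.

Lemma c_sqr_ge (k6 : (6 <= k)%N) (p0 : 0 < p) (p1 : p < 1) : 8^-1 <= c * (1 - s) ^+ 2.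
Proof.
have u0 : 0 < u by lra.
have u1 : u < 1 by lra.
have c0 := (c_gt0 k6 p0 p1); have /andP[s0 s1] := (sqrt_eta_bounds k6 p0 p1).
have v0 : 0 < Num.sqrt u by rewrite sqrtr_gt0.
have v1 : Num.sqrt u < 1 by rewrite -[ltRHS]sqrtr1 ltr_sqrt.
have uE : u = Num.sqrt u ^+ 2 by rewrite sqr_sqrtr// ltW.
have sv : s <= Num.sqrt u by rewrite ler_wsqrtr// (eta_le k6 p0 p1).
have h1 : 1 - u <= 2 * (1 - s) by nra.
have h2 : c^-1 <= 8 * (1 - s) ^+ 2.
  apply: (le_trans (c_inv_le k6 p0 p1)).
  have : (1 - u) ^+ 2 <= (2 * (1 - s)) ^+ 2 by apply: lerXn2r; rewrite ?nnegrE; lra.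
  rewrite exprMn; lra.
rewrite -ler_pdivrMl// mulrC; lra.
Qed.

Definition x_exponent : R := k%:R * ln 2 * (c * (1 - s) ^+ 2).

Lemma x_pE (k6 : (6 <= k)%N) (p0 : 0 < p) (p1 : p < 1) : x_p k p =
  expR (- x_exponent) / Num.sqrt (Num.max (c * k%:R * s) 1).
Proof.
rewrite /x_p sqrtrM ?expR_ge0// sqrtrV; last by rewrite le_max ler01 orbT.
congr (_ / _).
have -> : - (k%:R * ln 2 * (2 * c * (1 - s) ^+ 2)) = 2%:R * (- x_exponent).
  by rewrite /x_exponent; ring.
by rewrite expRM_natl sqrtr_sqr ger0_norm// expR_ge0.
Qed.

Lemma x_exponent_bounds (k6 : (6 <= k)%N) (p0 : 0 < p) (p1 : p < 1) : k%:R / 16 <= x_exponent <= 16 * k%:R.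
Proof.
have /andP[l1 l2] := ln2_bounds; have h1 := (c_sqr_le k6 p0 p1); have h2 := (c_sqr_ge k6 p0 p1).
have k0 : 0 < k%:R :> R by rewrite ltr0n; lia.
rewrite /x_exponent; set y := c * _ in h1 h2 *.
have l8 : 16^-1 <= ln 2 * y.
  have : 2^-1 * 8^-1 <= ln 2 * y by apply: ler_pM.
  lra.
have l16 : ln 2 * y <= 16.
  have : ln 2 * y <= 1 * 16 by apply: ler_pM => //; lra.
  lra.
apply/andP; split; first by rewrite -mulrA ler_pM2l.
by rewrite -mulrA mulrC ler_pM2r.
Qed.

Lemma x_p_gt0 (k6 : (6 <= k)%N) (p0 : 0 < p) (p1 : p < 1) : 0 < x_p k p.
Proof.
by rewrite (x_pE k6 p0 p1) divr_gt0 ?expR_gt0// sqrtr_gt0 lt_max ltr01 orbT.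
Qed.

Lemma x_p_le_exp (k6 : (6 <= k)%N) (p0 : 0 < p) (p1 : p < 1) : x_p k p <= expR (- x_exponent).
Proof.
rewrite (x_pE k6 p0 p1) ler_pdivrMr; last by rewrite sqrtr_gt0 lt_max ltr01 orbT.
rewrite ler_peMr ?expR_ge0// -[leLHS]sqrtr1 ler_wsqrtr// le_max lexx orbT//.
Qed.

Lemma x_p_le1 (k6 : (6 <= k)%N) (p0 : 0 < p) (p1 : p < 1) : x_p k p <= 1.
Proof.
apply: (le_trans (x_p_le_exp k6 p0 p1)); rewrite -(@expR0 R) ler_expR oppr_le0.
have /andP[h _] := (x_exponent_bounds k6 p0 p1); apply: le_trans h.
by rewrite divr_ge0.
Qed.

Lemma x_p_le_sqr (k6 : (6 <= k)%N) (p0 : 0 < p) (p1 : p < 1) : x_p k p <= 512 / k%:R ^+ 2.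
Proof.
have k0 : 0 < k%:R :> R by rewrite ltr0n; lia.
apply: (le_trans (x_p_le_exp k6 p0 p1)).
have /andP[h _] := (x_exponent_bounds k6 p0 p1).
apply: (@le_trans _ _ (expR (- (k%:R / 16)))); first by rewrite ler_expR lerN2.
have k16 : 0 <= k%:R / 16 :> R by rewrite divr_ge0.
have := expR_ge1Dxn 1 k16; rewrite expRN => e.
have -> : 512 / k%:R ^+ 2 = ((k%:R / 16) ^+ 2 / 2)^-1 :> R.
  by field; rewrite gt_eqF.
rewrite lef_pV2 ?posrE ?expR_gt0 ?divr_gt0 ?exprn_gt0 ?divr_gt0//.
apply: le_trans e; by rewrite -[leLHS]add0r; apply: lerD.
Qed.

Lemma alpha_ubd_gt0 (k6 : (6 <= k)%N) (p0 : 0 < p) (p1 : p < 1) : 0 < alpha_ubd k p.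
Proof.
have /andP[l1 _] := ln2_bounds.
by rewrite /alpha_ubd !mulr_gt0 ?(c_gt0 k6 p0 p1) ?exprn_gt0//; lra.
Qed.

Lemma alpha_ubdE (k6 : (6 <= k)%N) (p0 : 0 < p) (p1 : p < 1) : alpha_ubd k p * (q * c^-1) = ln 2.
Proof.
have Q32 := (pow_32 k6).
by rewrite /alpha_ubd (viol_probE k6); field; rewrite !gt_eqF ?(c_gt0 k6 p0 p1)//; lra.
Qed.
End EnergyFunctions.

(** * Choice of the window *)

Lemma expR_le_1B (R : realType) (tau : R) : 0 <= tau <= 2^-1 ->
  expR (- (tau + 2 * tau ^+ 2)) <= 1 - tau.
Proof.
move=> /andP[t0 t1].
have -> : 1 - tau = expR (ln (1 - tau)) by rewrite lnK// posrE; lra.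
rewrite ler_expR; have := @ln_ge_div R (- tau); rewrite ltrN2 => h.
apply: (@le_trans _ _ (- tau / (1 - tau))); last by apply: h; lra.
rewrite mulNr lerN2 ler_pdivrMr; last by lra.
have : 0 <= tau ^+ 2 * (1 - 2 * tau) by rewrite mulr_ge0 ?sqr_ge0//; lra.
by rewrite !expr2; lra.
Qed.

(** The factor [1 - tau] lost per step is [exp (- tau)] up to a second order
    term, which is negligible since [tau] is of the order of [b]. *)
Lemma return_window (R : realType) (d : nat) (b a0 b0 s rho X : R) :
  0 <= a0 -> 0 < b -> b <= 31^-1 -> 0 <= s -> s <= 1 -> 0 <= rho ->
  a0 <= s ^+ 2 * b -> b <= b0 -> b0 <= 2 * b ->
  Num.sqrt b0 - Num.sqrt a0 <= Num.sqrt b * (1 - s + rho) ->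
  d%:R * b * (1 - s + rho) ^+ 2 <= X ->
  expR (- (X + 4 * b * X)) / (32 * (Num.sqrt (2 * (d%:R * b * s)) + 1)) <=
  iter d (walk a0 b0) (delta_at R 0) 0.
Proof.
move=> a00 bp b31 s0 s1 rho0 a0b bb0 b0b dif dX.
have b8 : b0 <= 8^-1 by lra.
have s21 : s ^+ 2 <= 1 by rewrite exprn_ile1.
have a0b1 : a0 <= b by apply: (le_trans a0b); rewrite ler_piMl// ltW.
have a8 : a0 <= 8^-1 by lra.
have b00 : 0 <= b0 by lra.
have dif0 : 0 <= Num.sqrt b0 - Num.sqrt a0 by rewrite subr_ge0 ler_wsqrtr//; lra.
apply: le_trans (return_ge d a00 b00 a8 b8).
set tau := _ ^+ 2.
have t0 : 0 <= tau by rewrite sqr_ge0.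
have tb : tau <= 2 * b.
  apply: le_trans b0b; rewrite -[leRHS]sqr_sqrtr//.
  by apply: lerXn2r; rewrite ?nnegrE ?sqrtr_ge0// gerDl oppr_le0 sqrtr_ge0.
have dt : d%:R * tau <= X.
  apply: le_trans dX; rewrite -mulrA ler_wpM2l//.
  have -> : b * (1 - s + rho) ^+ 2 = (Num.sqrt b * (1 - s + rho)) ^+ 2.
    by rewrite exprMn sqr_sqrtr// ltW.
  by apply: lerXn2r; rewrite ?nnegrE// mulr_ge0 ?sqrtr_ge0//; lra.
have pw : expR (- (X + 4 * b * X)) <= (1 - tau) ^+ d.
  apply: (@le_trans _ _ (expR (d%:R * (- (tau + 2 * tau ^+ 2))))).
    rewrite ler_expR mulrN lerN2 mulrDr lerD//.
    have : d%:R * tau * tau <= X * (2 * b) by rewrite ler_pM// mulr_ge0.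
    by rewrite expr2; lra.
  rewrite expRM_natl; apply: lerXn2r; rewrite ?nnegrE ?expR_ge0//; first by lra.
  by apply: expR_le_1B; lra.
have sq : Num.sqrt (Num.sqrt (a0 * b0) * d%:R) <= Num.sqrt (2 * (d%:R * b * s)).
  rewrite ler_wsqrtr//.
  have : Num.sqrt (a0 * b0) <= 2 * s * b.
    have sb0 : 0 <= 2 * s * b by rewrite !mulr_ge0// ltW.
    have -> : 2 * s * b = Num.sqrt ((2 * s * b) ^+ 2) by rewrite sqrtr_sqr ger0_norm.
    rewrite ler_wsqrtr//.
    have : a0 * b0 <= (s ^+ 2 * b) * (2 * b) by rewrite ler_pM.
    have : 0 <= s ^+ 2 * b * b by rewrite !mulr_ge0 ?sqr_ge0// ltW.
    by rewrite !exprMn; lra.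
  have d0 : 0 <= d%:R :> R by [].
  by move=> h; have := ler_wpM2r d0 h; lra.
rewrite ler_pM ?expR_ge0 ?invr_ge0 ?mulr_ge0 ?addr_ge0 ?sqrtr_ge0//.
rewrite lef_pV2 ?posrE ?mulr_gt0 ?ltr_wpDl ?sqrtr_ge0//.
by rewrite ler_pM2l// lerD2r.
Qed.

(** The bounded factors lost between [x_p] and the return probability; see
    [window_constant]. *)
Definition delta0 (R : realType) : R := expR (- 162).

Lemma delta0_gt0 (R : realType) : 0 < delta0 R. Proof. exact: expR_gt0. Qed.

Lemma delta0_le (R : realType) : delta0 R * 3072 <= 1.
Proof.
have e : 3072 <= expR (162 : R).
  have h : 0 <= 162 :> R by lra.
  have := expR_ge1Dxn 1 h; have -> : (2`!)%:R = 2 :> R by [].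
  lra.
by have := ler_wpM2l (expR_ge0 (- 162 : R)) e; rewrite -expRD addNr expR0.
Qed.

(** With a relative perturbation [rho] of order [1 / sqrt (K * L)], the drift
    exponent [L * (1 - s) ^+ 2], of order at most [K], changes by [O(1)]: the
    cross term is split by the inequality of means with weight [K]. *)
Lemma drift_perturbation (R : realType) (K L X s rho r : R) :
  6 <= K -> 0 < L -> 0 <= X -> X <= 16 * K -> L * (1 - s) ^+ 2 <= X + 16 ->
  L * r ^+ 2 = K^-1 -> 0 <= rho -> rho <= 3 / 2 * r ->
  L * (1 - s + rho) ^+ 2 <= X + 40.
Proof.
move=> K6 L0 X0 X16 LX Lr rho0 rhor.
have K0 : 0 < K by clear -K6; lra.
have KV0 : 0 < K^-1 by rewrite invr_gt0.
have KV : K^-1 <= 6^-1 by rewrite lef_pV2 ?posrE//; lra.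
have cross : (1 - s + rho) ^+ 2 <= (1 - s) ^+ 2 * (1 + K^-1) + rho ^+ 2 * (1 + K).
  have : 0 <= ((1 - s) - K * rho) ^+ 2 / K by rewrite divr_ge0 ?sqr_ge0// ltW.
  have -> : ((1 - s) - K * rho) ^+ 2 / K =
    (1 - s) ^+ 2 * K^-1 + K * rho ^+ 2 - 2 * (1 - s) * rho by field; rewrite gt_eqF.
  by clear; rewrite !expr2; lra.
have r2 : L * rho ^+ 2 <= 9 / 4 * K^-1.
  have : rho ^+ 2 <= (3 / 2 * r) ^+ 2.
    by apply: lerXn2r => //; rewrite nnegrE; apply: le_trans rhor.
  rewrite -(ler_pM2l L0) => h; apply: (le_trans h).
  by rewrite exprMn mulrCA Lr; clear; lra.
have XV : (X + 16) * K^-1 <= 19 by rewrite ler_pdivrMr//; clear -X16 K6; lra.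
have h1 := ler_wpM2l (ltW L0) cross.
have h2 : L * (1 - s) ^+ 2 * (1 + K^-1) <= (X + 16) * (1 + K^-1).
  by rewrite ler_pM2r// addr_gt0.
have h3 : L * rho ^+ 2 * (1 + K) <= 9 / 4 * K^-1 * (1 + K).
  by rewrite ler_pM2r// addr_gt0.
have h4 : 9 / 4 * K^-1 * (1 + K) = 9 / 4 + 9 / 4 * K^-1 by field; rewrite gt_eqF.
rewrite h4 in h3.
rewrite mulrDr (mulrA L ((1 - s) ^+ 2)) (mulrA L (rho ^+ 2)) in h1.
apply: (le_trans h1); apply: (le_trans (lerD h2 h3)).
by rewrite mulrDr mulr1; clear -XV KV; lra.
Qed.

Lemma sqrt_perturbation (R : realType) (b s r t : R) :
  0 < b -> 0 <= s -> 0 <= r -> 0 <= t <= 1 ->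
  Num.sqrt (b * (1 + r)) - Num.sqrt (s ^+ 2 * b * (1 - t)) <=
  Num.sqrt b * (1 - s + (r / 2 + s * t)).
Proof.
move=> b0 s0 r0 /andP[t0 t1].
have t10 : 0 <= 1 - t by rewrite subr_ge0.
rewrite sqrtrM ?(ltW b0)// sqrtrM ?mulr_ge0 ?(ltW b0)//.
rewrite sqrtrM ?mulr_ge0// sqrtr_sqr ger0_norm//.
have -> : Num.sqrt b * Num.sqrt (1 + r) - s * Num.sqrt b * Num.sqrt (1 - t) =
  Num.sqrt b * (Num.sqrt (1 + r) - s * Num.sqrt (1 - t)) by ring.
rewrite ler_pM2l ?sqrtr_gt0//.
have up : Num.sqrt (1 + r) <= 1 + r / 2.
  have hh : 0 <= 1 + r / 2 by clear -r0; lra.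
  have -> : 1 + r / 2 = Num.sqrt ((1 + r / 2) ^+ 2).
    by rewrite sqrtr_sqr ger0_norm.
  by rewrite ler_wsqrtr//; have := sqr_ge0 (r / 2); rewrite !expr2; clear; lra.
have lo : 1 - t <= Num.sqrt (1 - t).
  have {1}-> : 1 - t = Num.sqrt ((1 - t) ^+ 2) by rewrite sqrtr_sqr ger0_norm.
  by rewrite ler_wsqrtr// expr2 ler_piMr// gerBl.
have : s * (1 - t) <= s * Num.sqrt (1 - t) by rewrite ler_wpM2l.
by clear -up; lra.
Qed.

Lemma window_constant (R : realType) (b X K y mx : R) :
  6 <= K -> 0 < b -> b * K <= 1 -> 0 <= X -> X <= 16 * K ->
  0 <= y -> y <= 4 * mx -> 1 <= mx ->
  delta0 R * (expR (- X) / Num.sqrt mx) * 4 <=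
  expR (- (X + 40 + 4 * b * (X + 40))) / (32 * (Num.sqrt y + 1)).
Proof.
move=> K6 b0 bK X0 X16 y0 ymx mx1.
have m1 : 1 <= Num.sqrt mx by rewrite -[leLHS]sqrtr1 ler_wsqrtr.
have mx0 : 0 < Num.sqrt mx by apply: lt_le_trans m1.
have sq : Num.sqrt y <= 2 * Num.sqrt mx.
  have -> : 2 * Num.sqrt mx = Num.sqrt (2 ^+ 2 * mx).
    by rewrite sqrtrM// sqrtr_sqr ger0_norm.
  by rewrite ler_wsqrtr// expr2 -natrM.
have q0 := sqrtr_ge0 y.
have den : (96 * Num.sqrt mx)^-1 <= (32 * (Num.sqrt y + 1))^-1.
  by rewrite lef_pV2 ?posrE; clear -q0 sq m1; lra.
(* [131] bounds [40 + 4 * b * (X + 40)], because [b * X <= 16] and [b <= 1 / 6] *)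
have num : expR (- (X + 131)) <= expR (- (X + 40 + 4 * b * (X + 40))).
  rewrite ler_expR lerN2.
  have h1 : b * X <= b * (16 * K) by rewrite ler_pM2l.
  have h2 : b * 6 <= b * K by rewrite ler_pM2l.
  by clear -h1 h2 bK; lra.
(* [384 = 4 * 96], and [162 = 131 + 31] *)
have e31 : 384 <= expR (31 : R).
  have h : 0 <= 31 :> R by clear; lra.
  have := expR_ge1Dxn 1 h; have -> : (2`!)%:R = 2 :> R by [].
  by clear; lra.
have dE : delta0 R * expR (- X) * 384 <= expR (- (X + 131)).
  have -> : - (X + 131) = - 162 + - X + 31 by ring.
  by rewrite /delta0 expRD expRD ler_wpM2l// mulr_ge0 ?expR_ge0.
have p96 : 0 <= (96 * Num.sqrt mx)^-1 by rewrite invr_ge0 mulr_ge0 ?(ltW mx0).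
apply: le_trans (ler_pM (expR_ge0 _) p96 num den).
rewrite ler_pdivlMr ?mulr_gt0//; apply: le_trans dE.
rewrite le_eqVlt; apply/orP; left; apply/eqP.
by field; rewrite gt_eqF.
Qed.

(** The window is so narrow that it changes the return probability by a bounded
    factor only; but deviations from it still cost at least of the order of
    [1 / k ^+ 2] per variable. *)
Lemma narrow_window (R : realType) (k d : nat) (s b X mx : R) : (6 <= k)%N ->
  0 < s -> s < 1 -> 0 < b -> b * k%:R <= 1 -> b <= 31^-1 ->
  1 <= k%:R * (d%:R * b) -> d%:R * b * (1 - s) ^+ 2 <= X + 16 ->
  0 <= X -> X <= 16 * k%:R -> d%:R * b * s <= 2 * mx -> 1 <= mx ->
  exists ra rb : R, [/\ 0 <= ra <= 1, 0 <= rb <= 1,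
    s ^+ 2 * b * (1 - ra) + b * (1 + rb) <= 1,
    delta0 R * (expR (- X) / Num.sqrt mx) <=
      iter d (walk (s ^+ 2 * b * (1 - ra)) (b * (1 + rb))) (delta_at R 0) 0 / 4 &
    (ra < 1 -> (4 * k%:R ^+ 2)^-1 <= d%:R / k%:R * (s ^+ 2 * b) * ra ^+ 2 / 4) /\
    (6 * k%:R)^-1 <= d%:R * b * rb ^+ 2 / 6].
Proof.
move=> k6 s0 s1 b0 bk b31 kL LX X0 X16 Ls mx1.
have kR6 : 6 <= k%:R :> R by rewrite ler_nat.
have kR : 0 < k%:R :> R by apply: lt_le_trans kR6.
have kL0 : 0 < k%:R * (d%:R * b) by apply: lt_le_trans kL.
have L0 : 0 < d%:R * b by move: kL0; rewrite pmulr_rgt0.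
have [rb rbE] : exists rb, rb = (Num.sqrt (k%:R * (d%:R * b)))^-1 by eexists.
have [ra raE] : exists ra, ra = Num.min 1 (rb / s) by eexists.
have rb0 : 0 < rb by rewrite rbE invr_gt0 sqrtr_gt0.
have rb1 : rb <= 1.
  by rewrite rbE invf_le1 ?sqrtr_gt0// -[leLHS]sqrtr1 ler_wsqrtr.
have rb2 : d%:R * b * rb ^+ 2 = k%:R^-1.
  rewrite rbE exprVn sqr_sqrtr ?(ltW kL0)// invfM mulrCA mulfV ?mulr1//.
  by rewrite gt_eqF.
have ra0 : 0 <= ra by rewrite raE le_min ler01 divr_ge0// ltW.
have ra1 : ra <= 1 by rewrite raE ge_min lexx.
have ra10 : 0 <= 1 - ra by rewrite subr_ge0.
have sra : s * ra <= rb by rewrite mulrC -ler_pdivlMr// raE ge_min lexx orbT.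
have s20 : 0 <= s ^+ 2 by rewrite sqr_ge0.
have s21 : s ^+ 2 <= 1 by rewrite exprn_ile1// ltW.
have sb0 : 0 <= s ^+ 2 * b by rewrite mulr_ge0// ltW.
have sb : s ^+ 2 * b * (1 - ra) <= s ^+ 2 * b by rewrite ler_piMr// gerBl.
have sb1 : s ^+ 2 * b <= b by rewrite ler_piMl// ltW.
have brb : b * (1 + rb) <= 2 * b.
  by rewrite mulrC ler_pM2r//; clear -rb1; lra.
exists ra, rb; split => //; rewrite ?ra0 ?ra1 ?rb1 ?(ltW rb0)//.
- by clear -sb sb1 brb b31; lra.
- have rho0 : 0 <= rb / 2 + s * ra.
    by rewrite addr_ge0 ?mulr_ge0 ?invr_ge0 ?(ltW rb0) ?(ltW s0).
  have rho2 : rb / 2 + s * ra <= 3 / 2 * rb by clear -sra; lra.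
  have Y := drift_perturbation kR6 L0 X0 X16 LX rb2 rho0 rho2.
  have ra01 : 0 <= ra <= 1 by rewrite ra0.
  have dif := sqrt_perturbation b0 (ltW s0) (ltW rb0) ra01.
  have sb2 : 0 <= s ^+ 2 * b * (1 - ra) by rewrite mulr_ge0.
  have bb : b <= b * (1 + rb) by rewrite ler_pMr// lerDl ltW.
  rewrite ler_pdivlMr//.
  apply: le_trans (return_window sb2 b0 b31 (ltW s0) (ltW s1) rho0 sb bb brb dif Y).
  apply: window_constant bk X0 X16 _ _ mx1 => //.
    by rewrite !mulr_ge0 ?(ltW b0) ?(ltW s0).
  by clear -Ls; lra.
- split => [ra_lt|]; last by rewrite rb2 invfM mulrC.
  have {}raE : ra = rb / s.
    by move: ra_lt; rewrite raE /Num.min; case: ifP => // _; rewrite ltxx.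
  rewrite raE.
  have -> : d%:R / k%:R * (s ^+ 2 * b) * (rb / s) ^+ 2 / 4 =
    d%:R * b * rb ^+ 2 * (4 * k%:R)^-1 by clear -kR s0; field; rewrite !gt_eqF.
  by rewrite rb2 -invfM expr2 mulrCA.
Qed.

Lemma window_choice (R : realType) (k d : nat) (p : R) (a := tilt_viol k (eta_p k p))
    (b := tilt_crit k (eta_p k p)) :
  (6 <= k)%N -> 0 < p -> p < 1 ->
  d%:R / k%:R <= alpha_ubd k p -> alpha_ubd k p / 2 <= d%:R / k%:R ->
  exists ra rb : R, [/\ 0 <= ra <= 1, 0 <= rb <= 1,
    a * (1 - ra) + b * (1 + rb) <= 1,
    delta0 R * x_p k p <=
      iter d (walk (a * (1 - ra)) (b * (1 + rb))) (delta_at R 0) 0 / 4 &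
    (ra < 1 -> delta0 R * x_p k p <= d%:R / k%:R * a * ra ^+ 2 / 4) /\
    delta0 R * x_p k p <= d%:R * b * rb ^+ 2 / 6].
Proof.
move=> k6 p0 p1 dle dge.
have Q32 := pow_32 R k6; have Qk := pow_gt_k R k6; have qE := viol_probE R k6.
set Q := 2 ^+ k.-1 in Q32 Qk qE.
have /andP[l1 l2] := ln2_bounds R.
have kR6 : 6 <= k%:R :> R by rewrite ler_nat.
have kR : 0 < k%:R :> R by apply: lt_le_trans kR6.
have /andP[s0 s1] := sqrt_eta_bounds k6 p0 p1.
have e0 := eta_gt0 k6 p0 p1.
have c0 := c_gt0 k6 p0 p1; have c2 := c_ge k6 p0 p1.
have c16 := c_sqr_le k6 p0 p1.
have xE := x_pE k6 p0 p1; have x512 := x_p_le_sqr k6 p0 p1.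
have x0 := x_p_gt0 k6 p0 p1.
have /andP[X0 X16] := x_exponent_bounds k6 p0 p1.
have bE : b = Q^-1 * ((Q - (1 - p)) / (Q - 1)) by rewrite -qE -tilt_critE.
have aE : a = Num.sqrt (eta_p k p) ^+ 2 * b.
  rewrite sqr_sqrtr; last exact: ltW.
  by rewrite /a /b /tilt_viol /tilt_crit -mulrA mulrCA.
have alE : alpha_ubd k p * Q^-1 = c_p k p * ln 2.
  rewrite -qE -[RHS]mulrC -(alpha_ubdE k6 p0 p1) -!mulrA mulVf ?mulr1//.
  by rewrite gt_eqF.
have XE : x_exponent k p = k%:R * ln 2 *
  (c_p k p * (1 - Num.sqrt (eta_p k p)) ^+ 2) by [].
move: (x_p k p) (x_exponent k p) XE xE X0 X16 x512 x0
  => x X XE xE X0 X16 x512 x0.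
move: a b aE bE => a b aE bE.
move: (Num.sqrt (eta_p k p)) aE s0 s1 c16 xE XE => s aE s0 s1 c16 xE XE.
move: (c_p k p) c0 c2 c16 XE xE alE => c c0 c2 c16 XE xE alE.
move: (alpha_ubd k p) dle dge alE => al dle dge alE.
have [z zE] : exists z, z = (Q - (1 - p)) / (Q - 1) by eexists.
rewrite -zE in bE.
have Q10 : 0 < Q - 1 by clear -Q32; lra.
have z1 : 1 <= z by rewrite zE ler_pdivlMr// mul1r; clear -p0; lra.
have zk : z <= 1 + k%:R^-1.
  have -> : z = 1 + p / (Q - 1) by rewrite zE; clear -Q10; field; rewrite gt_eqF.
  rewrite lerD2l ler_pdivrMr// mulrC ler_pdivlMr//.
  have h : p * k%:R <= k%:R by rewrite ler_piMl// ltW.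
  by rewrite -natr1 in Qk; clear -h Qk; lra.
have kV0 : 0 < k%:R^-1 :> R by rewrite invr_gt0.
have kV : k%:R^-1 <= 6^-1 :> R by rewrite lef_pV2 ?posrE//; lra.
have Q0 : 0 < Q by clear -Q32; lra.
have bp : 0 < b by rewrite bE mulr_gt0 ?invr_gt0// (lt_le_trans ltr01).
have bQ : b * (Q - 1) <= 1.
  have -> : b * (Q - 1) = (Q - (1 - p)) / Q.
    by rewrite bE zE; clear -Q10 Q0; field; rewrite !gt_eqF.
  by rewrite ler_pdivrMr//; clear -p1; lra.
have bk : b * k%:R <= 1.
  by apply: le_trans bQ; rewrite ler_pM2l//; rewrite -natr1 in Qk; clear -Qk; lra.
have b31 : b <= 31^-1.
  by rewrite -div1r ler_pdivlMr//; apply: le_trans bQ; rewrite ler_pM2l//; clear -Q32; lra.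
have dk : d%:R = k%:R * (d%:R / k%:R) :> R by field; rewrite gt_eqF.
have cE : k%:R * al * b = k%:R * c * ln 2 * z.
  by rewrite bE -[k%:R * c * ln 2]mulrA -alE; ring.
have Lle : d%:R * b <= k%:R * c * ln 2 * z.
  by rewrite -cE ler_pM2r// dk ler_pM2l.
have Lge : k%:R * c * ln 2 * z <= 2 * (d%:R * b).
  by rewrite -cE mulrA ler_pM2r// dk mulrCA ler_pM2l//; clear -dge; lra.
pose mx := Num.max (c * k%:R * s) 1.
have XX : 0 <= X by apply: le_trans X0; rewrite divr_ge0// ltW.
have kc0 : 0 < k%:R * c by rewrite mulr_gt0.
have [] := @narrow_window R k d s b X mx k6 s0 s1 bp bk b31.
- have : 6 * 2^-1 <= k%:R * c by rewrite ler_pM.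
  have h1 : 2^-1 <= ln 2 * z by rewrite -[leLHS]mulr1 ler_pM.
  have h2 : k%:R * c * 2^-1 <= k%:R * c * (ln 2 * z) by rewrite ler_pM2l.
  rewrite mulrA in h2 => h3.
  have h4 : 2^-1 <= d%:R * b by clear -h2 h3 Lge; lra.
  have h5 : 6 * 2^-1 <= k%:R * (d%:R * b) by rewrite ler_pM.
  by clear -h5; lra.
- have h1 : d%:R * b * (1 - s) ^+ 2 <= X * z.
    have -> : X * z = k%:R * c * ln 2 * z * (1 - s) ^+ 2 by rewrite XE; ring.
    by rewrite ler_wpM2r ?sqr_ge0.
  have h2 : X * z <= X * (1 + k%:R^-1) by rewrite ler_wpM2l.
  have h3 : X * k%:R^-1 <= 16 by rewrite ler_pdivrMr.
  by apply: (le_trans h1); apply: (le_trans h2); clear -h3; lra.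
- exact: XX.
- exact: X16.
- have h1 : d%:R * b * s <= k%:R * c * ln 2 * z * s by rewrite ler_pM2r.
  have h2 : ln 2 * z <= 2.
    have l0 : 0 <= ln (2 : R) by clear -l1; lra.
    have h : ln 2 * z <= 1 * (1 + k%:R^-1).
      by rewrite ler_pM// (le_trans ler01).
    by clear -h kV; lra.
  have h3 : c * k%:R * s <= mx by rewrite /mx le_max lexx.
  have h4 : (c * k%:R * s) * (ln 2 * z) <= (c * k%:R * s) * 2.
    by rewrite ler_pM2l// !mulr_gt0.
  have h5 : k%:R * c * ln 2 * z * s = (c * k%:R * s) * (ln 2 * z) by ring.
  by rewrite h5 in h1; apply: (le_trans h1); apply: (le_trans h4); clear -h3; lra.
- by rewrite /mx le_max lexx orbT.
move=> ra [rb [ra01 rb01 ab g [h1 h2]]].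
have small : delta0 R * x <= (6 * k%:R ^+ 2)^-1.
  have h3 : delta0 R * x <= delta0 R * (512 / k%:R ^+ 2).
    by rewrite ler_pM2l ?delta0_gt0.
  apply: (le_trans h3).
  have k2 : 0 < (k%:R ^+ 2)^-1 :> R by rewrite invr_gt0 exprn_gt0.
  have h4 := delta0_le R; rewrite -(ler_pM2r k2) in h4.
  rewrite invfM; clear -h4 k2; lra.
have k21 : k%:R <= k%:R ^+ 2 :> R.
  by rewrite expr2 ler_peMr ?(ltW kR)//; clear -kR6; lra.
exists ra, rb; rewrite aE; split => //; first by rewrite xE.
have k20 : 0 < k%:R ^+ 2 :> R by rewrite exprn_gt0.
split=> [/h1|]; [apply: le_trans|apply: le_trans h2]; apply: (le_trans small);
  rewrite lef_pV2 ?posrE ?mulr_gt0//; clear -k20 k21 kR; lra.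
Qed.

(** * Large instances *)

Section Limit.
Variable R : realType.

Lemma exp_decay (g : R) (N : nat) : 0 < g -> (0 < N)%N ->
  expR (- (g * N%:R)) * N%:R ^+ 3 <= 24 / g ^+ 4 / N%:R.
Proof.
move=> g0 N0; have NR : 0 < N%:R :> R by rewrite ltr0n.
have gN : 0 <= g * N%:R by rewrite mulr_ge0 ?(ltW g0).
have e : (g * N%:R) ^+ 4 / 24 <= expR (g * N%:R).
  have := expR_ge1Dxn 3 gN; have -> : (4`!)%:R = 24 :> R by [].
  by apply: le_trans; rewrite lerDr.
have p0 : 0 < (g * N%:R) ^+ 4 / 24 by rewrite divr_gt0// exprn_gt0// mulr_gt0.
rewrite expRN.
apply: (@le_trans _ _ (((g * N%:R) ^+ 4 / 24)^-1 * N%:R ^+ 3)).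
  by rewrite ler_wpM2r ?exprn_ge0// lef_pV2 ?posrE ?expR_gt0.
by rewrite le_eqVlt; apply/orP; left; apply/eqP; field; rewrite !gt_eqF.
Qed.

Lemma pow2_le_exp (D : nat) (y : R) : D%:R <= y -> 2 ^+ D <= expR y.
Proof.
move=> Dy; apply: (@le_trans _ _ (expR D%:R)); last by rewrite ler_expR.
rewrite -[D%:R]mulr1 expRM_natl; apply: lerXn2r; rewrite ?nnegrE ?expR_ge0//.
exact: expR_ge1Dx.
Qed.

Section Density.
Variables (k d : nat) (p : R).
Hypotheses (k6 : (6 <= k)%N) (p0 : 0 < p) (p1 : p < 1) (d0 : (0 < d)%N).
Local Notation density := (d%:R / k%:R : R).
Local Notation eta := (eta_p k p).
Local Notation rate := (density * (viol_prob R k * (c_p k p)^-1)).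

Let k0 : 0 < k%:R :> R. Proof. by rewrite ltr0n (leq_trans _ k6). Qed.

Let k2 : (2 < k)%N. Proof. exact: leq_trans k6. Qed.

Let eta01 : 0 < eta <= 1.
Proof. by rewrite (eta_gt0 k6 p0 p1) (ltW (eta_lt1 k6 p0 p1)). Qed.

Lemma clauses_per_variable (N M : nat) :
  (M * k = N * d)%N -> M%:R = N%:R * density :> R.
Proof.
move=> MkNd; apply: (mulIf (lt0r_neq0 k0)).
by rewrite mulrA divfK ?lt0r_neq0// -!natrM MkNd.
Qed.

Lemma pow_first_moment (N M : nat) : (M * k = N * d)%N ->
  2 ^+ N * first_moment M k eta = expR (- ((rate - ln 2) * N%:R)).
Proof.
move=> MkNd; rewrite (first_momentE k6 p0 p1) (clauses_per_variable MkNd).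
have -> : 2 ^+ N = expR (N%:R * ln 2) :> R by rewrite expRM_natl lnK ?posrE.
by rewrite -expRD; congr expR; ring.
Qed.

(** Above the threshold the plain first moment decays. *)
Lemma energy_fraction_above : alpha_ubd k p < density ->
  exists2 C : R, 0 <= C & forall N M, (0 < N)%N -> (M * k = N * d)%N ->
    energy_fraction N M d k (M%:R * tilt_viol k eta) <= C / N%:R.
Proof.
move=> above.
have [g gE] : exists g, g = rate - ln 2 by eexists.
have g0 : 0 < g.
  rewrite gE subr_gt0 -(alpha_ubdE k6 p0 p1) ltr_pM2r//.
  by rewrite mulr_gt0 ?viol_prob_gt0// invr_gt0 (c_gt0 k6 p0 p1).
exists ((d * k)%:R * (2 / g) + 2 / g).
  by rewrite addr_ge0 ?mulr_ge0 ?invr_ge0 ?(ltW g0).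
move=> N M N0 MkNd; have NR : 0 < N%:R :> R by rewrite ltr0n.
pose D := Num.truncn (g / 2 * N%:R).
have gN0 : 0 <= g / 2 * N%:R by rewrite mulr_ge0 ?divr_ge0 ?(ltW g0).
have /andP[D1 D2] := truncn_itv gN0.
apply: le_trans (energy_fraction_plain D k2 MkNd eta01) _.
rewrite mulrDl lerD//.
  rewrite -mulrA ler_wpM2l//.
  have -> : 2 / g / N%:R = (g / 2 * N%:R)^-1 by field; rewrite !gt_eqF.
  by rewrite lef_pV2 ?posrE ?ltr0n ?(ltW D2)// !mulr_gt0.
rewrite (pow_first_moment MkNd) -gE.
apply: (@le_trans _ _ (expR (g / 2 * N%:R) * expR (- (g * N%:R)))).
  by rewrite ler_wpM2r ?expR_ge0// pow2_le_exp.
rewrite -expRD (_ : _ + _ = - (g / 2 * N%:R)); last by field.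
have -> : 2 / g / N%:R = (g / 2 * N%:R)^-1 by field; rewrite !gt_eqF.
rewrite expRN lef_pV2 ?posrE ?expR_gt0 ?mulr_gt0//.
have := expR_ge1Dx (g / 2 * N%:R); lra.
Qed.

(** Slightly below the first moment threshold: local optimality gains more
    than the first moment exceeds [1]. *)
Lemma energy_fraction_below : density <= alpha_ubd k p ->
  (1 - delta0 R / 2 * x_p k p) * alpha_ubd k p <= density ->
  exists2 C : R, 0 <= C & forall N M, (0 < N)%N -> (M * k = N * d)%N ->
    energy_fraction N M d k (M%:R * tilt_viol k eta) <= C / N%:R.
Proof.
move=> below close.
have al0 := alpha_ubd_gt0 k6 p0 p1.
have x0 := x_p_gt0 k6 p0 p1; have x1 := x_p_le1 k6 p0 p1.
have /andP[l1 l2] := ln2_bounds R.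
have [g gE] : exists g, g = delta0 R * x_p k p by eexists.
have g0 : 0 < g by rewrite gE mulr_gt0 ?delta0_gt0.
have g1 : g <= 1.
  have h := delta0_le R; have h0 := delta0_gt0 R.
  rewrite gE mulr_ile1 ?(ltW x0) ?(ltW h0)//; lra.
have half : alpha_ubd k p / 2 <= density.
  apply: le_trans close; rewrite mulrC ler_pM2r// mulrAC -gE; lra.
have [ra [rb [ra01 rb01 ab wg [wa wb]]]] := window_choice k6 p0 p1 below half.
have rate_ge : ln 2 - g / 2 <= rate.
  have -> : ln 2 - g / 2 = ln 2 - g / 2 * 1 by rewrite mulr1.
  apply: (@le_trans _ _ ((1 - g / 2) * ln 2)).
    have : g / 2 * ln 2 <= g / 2 * 1 by rewrite ler_pM2l// divr_gt0.
    lra.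
  rewrite -(alpha_ubdE k6 p0 p1) [leLHS]mulrA ler_pM2r.
    by apply: le_trans close; rewrite gE mulrAC.
  by rewrite mulr_gt0 ?viol_prob_gt0// invr_gt0 (c_gt0 k6 p0 p1).
pose C1 : R := (expR 1 * (2 * d%:R)) ^+ 3 * 3 * (24 / (g / 4) ^+ 4).
have C10 : 0 <= C1.
  by rewrite !mulr_ge0 ?exprn_ge0 ?invr_ge0 ?exprn_ge0 ?mulr_ge0 ?expR_ge0// ?divr_ge0 ?(ltW g0).
exists ((d * k)%:R * (4 / g) + C1).
  by rewrite addr_ge0// mulr_ge0// divr_ge0// ltW.
move=> N M N0 MkNd; have NR : 0 < N%:R :> R by rewrite ltr0n.
(* of the gain [g], a share [g / 4] pays for the doubled variables and [g / 2]
   for the excess of the first moment *)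
pose D := Num.truncn (g / 4 * N%:R).
have gN0 : 0 <= g / 4 * N%:R by rewrite mulr_ge0 ?divr_ge0 ?(ltW g0).
have /andP[D1 D2] := truncn_itv gN0.
apply: le_trans (energy_fraction_window D k2 MkNd N0 d0 eta01 ra01 rb01 ab) _.
rewrite mulrDl lerD//.
  rewrite -mulrA ler_wpM2l//.
  have -> : 4 / g / N%:R = (g / 4 * N%:R)^-1 by field; rewrite !gt_eqF.
  by rewrite lef_pV2 ?posrE ?ltr0n ?(ltW D2)// !mulr_gt0.
rewrite (pow_first_moment MkNd).
set S := _ + _ + expR _.
have S3 : S <= 3 * expR (- (g * N%:R)).
  have t1 : expR (- (N%:R * iter d (walk (tilt_viol k eta * (1 - ra))
      (tilt_crit k eta * (1 + rb))) (delta_at R 0) 0 / 4)) <= expR (- (g * N%:R)).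
    by rewrite ler_expR lerN2 mulrC -mulrA ler_pM2l// gE.
  have t2 : (ra < 1)%R%:R * expR (- (M%:R * tilt_viol k eta * ra ^+ 2 / 4)) <=
      expR (- (g * N%:R)).
    case: (ltP ra 1) => ra1; last by rewrite mul0r expR_ge0.
    rewrite mul1r ler_expR lerN2 (clauses_per_variable MkNd).
    have -> : N%:R * density * tilt_viol k eta * ra ^+ 2 / 4 =
      N%:R * (density * tilt_viol k eta * ra ^+ 2 / 4) by ring.
    by rewrite mulrC ler_pM2l// gE; exact: wa.
  have t3 : expR (- ((M * k)%:R * tilt_crit k eta * rb ^+ 2 / 6)) <= expR (- (g * N%:R)).
    rewrite ler_expR lerN2 MkNd natrM.
    have -> : N%:R * d%:R * tilt_crit k eta * rb ^+ 2 / 6 =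
      N%:R * (d%:R * tilt_crit k eta * rb ^+ 2 / 6) by ring.
    by rewrite mulrC ler_pM2l// gE.
  by rewrite /S; lra.
have K3 : (expR 1 * (M * k).+1%:R) ^+ 3 <= (expR 1 * (2 * d%:R)) ^+ 3 * N%:R ^+ 3 :> R.
  rewrite -exprMn; apply: lerXn2r; rewrite ?nnegrE ?mulr_ge0 ?expR_ge0//.
  rewrite -!mulrA ler_wpM2l ?expR_ge0// -!natrM ler_nat MkNd.
  by rewrite [(d * N)%N]mulnC mul2n -addnn -addn1 leq_add2l muln_gt0 N0.
have P0 : expR (- ((rate - ln 2) * N%:R)) <= expR (g / 2 * N%:R).
  by rewrite ler_expR -mulNr ler_pM2r//; lra.
have D2x : 2 ^+ D <= expR (g / 4 * N%:R) by exact: pow2_le_exp.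
apply: (@le_trans _ _ (expR (g / 4 * N%:R) * ((expR 1 * (2 * d%:R)) ^+ 3 * N%:R ^+ 3 *
    (expR (g / 2 * N%:R) * (3 * expR (- (g * N%:R))))))).
  have S0 : 0 <= S by rewrite /S !addr_ge0 ?mulr_ge0 ?expR_ge0.
  apply: ler_pM; rewrite ?exprn_ge0 ?mulr_ge0 ?exprn_ge0 ?mulr_ge0 ?expR_ge0//.
  apply: ler_pM; rewrite ?exprn_ge0 ?mulr_ge0 ?exprn_ge0 ?mulr_ge0 ?expR_ge0//.
  by apply: ler_pM; rewrite ?expR_ge0.
have -> : expR (g / 4 * N%:R) * ((expR 1 * (2 * d%:R)) ^+ 3 * N%:R ^+ 3 *
    (expR (g / 2 * N%:R) * (3 * expR (- (g * N%:R))))) =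
  (expR 1 * (2 * d%:R)) ^+ 3 * 3 * (expR (- (g / 4 * N%:R)) * N%:R ^+ 3).
  have -> : - (g / 4 * N%:R) = g / 4 * N%:R + g / 2 * N%:R + - (g * N%:R) by field.
  by rewrite !expRD; ring.
rewrite /C1 -[leRHS]mulrA ler_wpM2l ?mulr_ge0 ?exprn_ge0 ?mulr_ge0 ?expR_ge0//.
by apply: exp_decay => //; rewrite divr_gt0.
Qed.

(** A typical minimum above [E] bounds the mean of the minimum from below. *)
Lemma expected_e_min_ge (N M : nat) (E : R) : (0 < N)%N -> (M * k = N * d)%N ->
  0 <= E -> E / N%:R * (1 - energy_fraction N M d k E) <= expected_e_min R d k N.
Proof.
move=> N0 MkNd E0; have NR : 0 < N%:R :> R by rewrite ltr0n.
have ME : (N * d %/ k)%N = M by rewrite -MkNd mulnK// (leq_trans _ k6).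
rewrite /expected_e_min ME /energy_fraction.
have I0 : 0 < #|instances N M d k|%:R :> R by rewrite ltr0n instances_gt0.
rewrite ler_pdivlMr// -[leLHS]mulrA mulrBl mul1r divfK ?gt_eqF//.
rewrite -sum1_card natr_sum (bigID (fun G => (min_violated G)%:R <= E))/=.
have -> : \sum_(G in instances N M d k | (min_violated G)%:R <= E) 1 =
    #|low_energy N M d k E|%:R :> R.
  by rewrite -sum1_card natr_sum; apply: eq_bigl => G; rewrite !inE.
rewrite addrAC subrr add0r mulr_sumr.
rewrite [leRHS](bigID (fun G => (min_violated G)%:R <= E))/=.
rewrite ler_wpDl//.
  by apply: sumr_ge0 => G _; case/andP: (e_min_bounds R G).
apply: ler_sum => G /andP[_ GE]; rewrite mulr1 /e_min ler_wpM2r ?invr_ge0//.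
by rewrite -ltNge in GE; exact: ltW.
Qed.

(** The energy exceeds the level of [p] with probability [1 - O(1 / N)], so its
    mean falls below that level by [O(1 / N)] at most. *)
Lemma p_bullet_le : (1 - delta0 R / 2 * x_p k p) * alpha_ubd k p < density ->
  p_bullet R d k <= p.
Proof.
move=> close.
have [C C0 HC] : exists2 C : R, 0 <= C & forall N M, (0 < N)%N -> (M * k = N * d)%N ->
    energy_fraction N M d k (M%:R * tilt_viol k eta) <= C / N%:R.
  have [above|below] := ltP (alpha_ubd k p) density.
    exact: energy_fraction_above.
  by apply: energy_fraction_below => //; exact: ltW.
have kn : (0 < k)%N by rewrite (leq_trans _ k6).
pose e : R := density * tilt_viol k eta.
have e0 : 0 < e.
  have /andP[h _] := eta01.
  by rewrite mulr_gt0 ?tilt_viol_gt0// divr_gt0// ltr0n.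
have eE : e = density * (1 - p) / 2 ^+ k.-1.
  by rewrite /e (tilt_violE k6 p0 p1) (viol_probE R k6); ring.
have low n : (0 < n)%N -> e - e * C / n%:R <= fine (liminf_e_min R d k).
  move=> n0; have nR : 0 < n%:R :> R by rewrite ltr0n.
  rewrite -lee_fin fineK ?liminf_e_min_fin_num// /liminf_e_min limf_einfE.
  pose f N := (expected_e_min R d k N)%:E.
  apply: le_ereal_sup_tmp.
  exists (ereal_inf (f @` [set N | (n <= N)%N /\ (k %| N * d)%N]%classic)).
    exists [set N | (n <= N)%N /\ (k %| N * d)%N]%classic => //.
    by exists n => // N /= nN kN.
  apply: le_ereal_inf_tmp => _ [N [nN kN] <-]; rewrite /f lee_fin.
  have N0 : (0 < N)%N by exact: leq_trans nN.
  have NR : 0 < N%:R :> R by rewrite ltr0n.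
  have MkNd : (N * d %/ k * k = N * d)%N by rewrite divnK.
  have h := HC N (N * d %/ k)%N N0 MkNd.
  set M := (N * d %/ k)%N in MkNd h.
  have EN : M%:R * tilt_viol k eta / N%:R = e.
    by rewrite (clauses_per_variable MkNd) /e; field; rewrite !gt_eqF.
  have E0 : 0 <= M%:R * tilt_viol k eta.
    have /andP[h0 _] := eta01.
    by rewrite mulr_ge0// ltW// tilt_viol_gt0.
  apply: le_trans (expected_e_min_ge N0 MkNd E0); rewrite EN.
  have -> : e - e * C / n%:R = e * (1 - C / n%:R) by ring.
  rewrite ler_pM2l// lerD2l lerN2; apply: (le_trans h).
  by rewrite ler_wpM2l// lef_pV2 ?posrE// ler_nat.
have ge : e <= fine (liminf_e_min R d k).
  rewrite leNgt; apply/negP => lt.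
  pose y := e - fine (liminf_e_min R d k).
  have y0 : 0 < y by rewrite subr_gt0.
  pose n := (Num.truncn (e * C / y)).+1.
  have n0 : (0 < n)%N by [].
  have nR : 0 < n%:R :> R by rewrite ltr0n.
  have eC : 0 <= e * C / y by rewrite divr_ge0 ?(ltW y0)// mulr_ge0// ltW.
  have /andP[_ h] := truncn_itv eC.
  have := low n n0; rewrite lerBlDl -lerBlDr -/y ler_pdivlMr// leNgt.
  by move=> /negP; apply; rewrite [ltRHS]mulrC -ltr_pdivrMr//; exact: h.
rewrite /p_bullet lerBlDl -lerBlDr.
have q0 : 0 < 2 ^+ k.-1 :> R by rewrite exprn_gt0.
have de0 : 0 < density by rewrite divr_gt0// ltr0n.
rewrite ler_pdivlMr// mulrC -ler_pdivrMr//.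
by rewrite -eE.
Qed.
End Density.
End Limit.

(** * Continuity in the energy parameter *)

Section Continuity.
Variable R : realType.
Import numFieldNormedType.Exports.
Local Open Scope classical_set_scope.

(** At [0] the limit of [w * ln w] is the conventional value [0 * ln 0 = 0]. *)
Lemma cvg_mul_ln (v : R) : 0 <= v -> (fun w : R => w * ln w) @ v --> v * ln v.
Proof.
rewrite le_eqVlt => /orP[/eqP <-|v0]; last first.
  by apply: cvgM; [exact: cvg_id|exact: continuous_ln].
rewrite mul0r.
have sq : (fun w : R => 2 * Num.sqrt w) @ (0 : R) --> (0 : R).
  rewrite -[X in _ --> X](mulr0 2) -[in X in _ --> X](@sqrtr0 R).
  by apply: cvgM; [exact: cvg_cst|exact: sqrt_continuous].
apply: (@squeeze_cvgr _ _ _ _ (fun w => - (2 * Num.sqrt w)) (fun w => 2 * Num.sqrt w)) => //; last first.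
  by rewrite -[X in _ --> X]oppr0; exact: (cvgN sq).
near=> w.
have w1 : w < 1 by near: w; exact: lt_nbhsl.
have [w0|w0] := leP w 0.
  by rewrite ln0// mulr0 oppr_le0 mulr_ge0 ?sqrtr_ge0.
have l0 : ln w <= 0 by rewrite ln_le0// ltW.
apply/andP; split; last first.
  apply: (@le_trans _ _ 0); first by rewrite mulr_ge0_le0// ltW.
  by rewrite mulr_ge0 ?sqrtr_ge0.
by have := mul_ln_ge w0; lra.
Unshelve. all: by end_near. Qed.

Lemma cvg_max1 (T : Type) (F : set_system T) (FF : Filter F) (f : T -> R) (y : R) :
  f x @[x --> F] --> y -> Num.max (f x) 1 @[x --> F] --> Num.max y 1.
Proof.
move=> fy; rewrite maxr_absE; under eq_fun do rewrite maxr_absE.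
apply: cvgM; last exact: cvg_cst.
apply: cvgD; first by apply: cvgD => //; exact: cvg_cst.
by apply: cvg_norm; apply: cvgB => //; exact: cvg_cst.
Qed.

Lemma cvg_threshold (k : nat) (delta p : R) : (6 <= k)%N -> 0 < p -> p <= 1 ->
  (fun t : R => (1 - delta * x_p k t) * alpha_ubd k t) @ p -->
  (1 - delta * x_p k p) * alpha_ubd k p.
Proof.
move=> k6 p0 p1; have Q32 := pow_32 R k6.
have cu : (fun t : R => 1 - t) @ p --> 1 - p by apply: cvgB; [exact: cvg_cst|exact: cvg_id].
set Q := 2 ^+ k.-1 in Q32.
have cQ : (fun t : R => Q - (1 - t)) @ p --> Q - (1 - p) by apply: cvgB => //; exact: cvg_cst.
have z0 : 1 < (Q - (1 - p)) / (Q - 1) by rewrite ltr_pdivlMr; lra.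
have cz : (fun t : R => (Q - (1 - t)) / (Q - 1)) @ p --> (Q - (1 - p)) / (Q - 1).
  by apply: cvgM => //; exact: cvg_cst.
have cc : c_p k @ p --> c_p k p.
  have h0 : (Q - (1 - p)) * ln ((Q - (1 - p)) / (Q - 1)) + (1 - p) * ln (1 - p) != 0.
    have [p1'|p1'] := ltP p 1.
      by rewrite -[_ + _]invrK invr_neq0// gt_eqF// (c_gt0 k6 p0 p1').
    have -> : p = 1 by apply/le_anti; rewrite p1.
    rewrite subrr mul0r addr0 subr0 gt_eqF// mulr_gt0//; first by lra.
    by rewrite ln_gt0// ltr_pdivlMr; lra.
  apply: cvgV => //; apply: cvgD; last first.
    have u0 : 0 <= 1 - p by lra.
    exact: (cvg_comp _ _ cu (cvg_mul_ln u0)).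
  apply: cvgM => //.
  apply: (cvg_comp _ _ cz); apply: continuous_ln; exact: lt_trans ltr01 z0.
have ce : eta_p k @ p --> eta_p k p.
  apply: cvgM; first by apply: cvgM => //; exact: cvg_cst.
  by apply: cvgV => //; rewrite -/Q gt_eqF//; lra.
have cs : (fun t => Num.sqrt (eta_p k t)) @ p --> Num.sqrt (eta_p k p).
  by apply: (cvg_comp _ _ ce); exact: sqrt_continuous.
have cx : x_p k @ p --> x_p k p.
  have m0 : Num.max (c_p k p * k%:R * Num.sqrt (eta_p k p)) 1 != 0 :> R.
    by rewrite gt_eqF// lt_max ltr01 orbT.
  apply: (@cvg_comp _ _ _ _ Num.sqrt _ (nbhs (expR (- (k%:R * ln 2 *
     (2 * c_p k p * (1 - Num.sqrt (eta_p k p)) ^+ 2))) /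
     Num.max (c_p k p * k%:R * Num.sqrt (eta_p k p)) 1))); last exact: sqrt_continuous.
  apply: cvgM.
    have cexp : (fun t => - (k%:R * ln 2 * (2 * c_p k t *
        (1 - Num.sqrt (eta_p k t)) ^+ 2))) @ p -->
        - (k%:R * ln 2 * (2 * c_p k p * (1 - Num.sqrt (eta_p k p)) ^+ 2)).
      apply: cvgN; apply: cvgM; first exact: cvg_cst.
      apply: cvgM; first by apply: cvgM => //; exact: cvg_cst.
      have c1 : (fun t => 1 - Num.sqrt (eta_p k t)) @ p --> 1 - Num.sqrt (eta_p k p).
        by apply: cvgB => //; exact: cvg_cst.
      exact: cvgM.
    by apply: (cvg_comp _ _ cexp); exact: continuous_expR.
  apply: cvgV => //; apply: cvg_max1.
  by apply: cvgM => //; apply: cvgM => //; exact: cvg_cst.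
apply: cvgM.
  by apply: cvgB; [exact: cvg_cst|apply: cvgM => //; exact: cvg_cst].
by apply: cvgM; [apply: cvgM => //; exact: cvg_cst|exact: cvg_cst].
Qed.

Lemma threshold_left (k : nat) (delta p alpha : R) : (6 <= k)%N -> 0 < p -> p <= 1 ->
  (1 - delta * x_p k p) * alpha_ubd k p < alpha ->
  exists t, [/\ 0 < t, t < p & (1 - delta * x_p k t) * alpha_ubd k t < alpha].
Proof.
move=> k6 p0 p1 lt.
have /cvg_at_left_filter h := @cvg_threshold k delta p k6 p0 p1.
have near_p : \forall t \near p^'-, (1 - delta * x_p k t) * alpha_ubd k t < alpha.
  exact: (cvgr_lt _ h).
have : \forall t \near p^'-, [/\ 0 < t, t < p &
    (1 - delta * x_p k t) * alpha_ubd k t < alpha].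
  near=> t; split; near: t => //.
  - exact: nbhs_left_gt.
  - exact: nbhs_left_lt.
by move=> /filter_ex[t ht]; exists t.
Unshelve. all: by end_near. Qed.
End Continuity.

Theorem corollary2p11 (R : realType) :
  exists (k0 : nat) (C delta : R),
    [/\ (0 < k0)%N, 0 < C, 0 < delta &
      forall (k : nat) (p : R),
        (k0 <= k)%N -> 0 <= p ->
        C * k%:R / 2 ^+ k <= p ^+ 2 -> p ^+ 2 <= 1 ->
        alpha_max_le k p ((1 - delta * x_p k p) * alpha_ubd k p)].
Proof.
exists 6, 1, (delta0 R / 2); split => //; first by rewrite divr_gt0 ?delta0_gt0.
move=> k p k6 p_ge0 Cp p2 d d0 lt.
have kR : 0 < k%:R :> R by rewrite ltr0n (leq_trans _ k6).
have p0 : 0 < p.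
  rewrite lt_neqAle p_ge0 andbT eq_sym; apply/eqP => pE.
  by move: Cp; rewrite pE expr0n/= leNgt divr_gt0 ?mul1r ?exprn_gt0.
have p1 : p <= 1 by rewrite -(@ler_pXn2r _ 2) ?nnegrE// expr1n.
have [t [t0 tp ht]] := threshold_left k6 p0 p1 lt.
exact: le_lt_trans (p_bullet_le k6 t0 (lt_le_trans tp p1) d0 ht) tp.
Qed.
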